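(* Let $n\ge 2$ and let $R=(r_{ij})$ and $R_0=(r_{0,ij})$ be non-singular $(n\times n)$-correlation matrices such that $R>R_0$ (i.e. $r_{ij}\ge r_{0,ij}$ for all $i,j$ and $R\ne R_0$), $r_{0,ij}>0$ for all $i,j$, and all off-diagonal elements $r_0^{ij}$ ($i\ne j$) of $R_0^{-1}$ satisfy $r_0^{ij}\le 0$. Then, for all positive numbers $x_1,\dots,x_n$ and every $\alpha>0$ with $2\alpha\in\mathbb{N}$ or $2\alpha>n-2$, the cumulative distribution function value $$G_\alpha(x_1,\dots,x_n;\,R_0+\tau(R-R_0))$$ is increasing in $\tau\in[0,1]$, which implies the inequality $$G_\alpha(x_1,\dots,x_n;R_0)<G_\alpha(x_1,\dots,x_n;R).$$
   Context: A correlation matrix is a real symmetric positive semi-definite matrix with all diagonal entries equal to $1$. $|A|$ denotes the determinant of a square matrix $A$, $I_n$ the identity matrix, and $T=\mathrm{diag}(t_1,\dots,t_n)$ with $t_1,\dots,t_n\ge0$; $\mathbb{N}=\{1,2,3,\dots\}$. For a non-singular $(n\times n)$-correlation matrix $R$ and $\alpha>0$, if the function $(t_1,\dots,t_n)\mapsto|I_n+RT|^{-\alpha}$ on $[0,\infty)^n$ is the Laplace transform $E\big(e^{-\sum_jt_jY_j}\big)$ of the distribution of a random vector $(Y_1,\dots,Y_n)$ with values in $[0,\infty)^n$, this distribution is called the $\Gamma_n(\alpha,R)$-distribution, and $G_\alpha(x_1,\dots,x_n;R)=P(Y_1\le x_1,\dots,Y_n\le x_n)$ denotes its cumulative distribution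 function. The $\Gamma_n(\alpha,R)$-distribution exists for every non-singular $(n\times n)$-correlation matrix $R$ if $2\alpha\in\mathbb{N}$ or $2\alpha>n-2$ ($\alpha>0$). ''Increasing'' means strictly increasing, as opposed to ''non-decreasing''. *)

(* Defs.v *)
From mathcomp Require Import all_boot all_order all_algebra.
From mathcomp Require Import all_classical all_reals all_analysis.

Set Implicit Arguments.
Unset Strict Implicit.
Unset Printing Implicit Defensive.
Import Order.TTheory GRing.Theory Num.Theory.
Import numFieldNormedType.Exports.
Local Open Scope classical_set_scope.
Local Open Scope ring_scope.

Definition correlation_matrix (K : realType) (n : nat) (R : 'M[K]_n) : Prop :=
  [/\ R^T = R,
      (forall v : 'cV[K]_n, 0 <= (v^T *m R *m v) 0 0) &
      (forall i, R i i = 1)].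

(* The distribution of a random vector with values in [0, +oo)^n is a
   probability on n.-tuple K giving mass 1 to the nonnegative orthant. The
   determinant below is positive for the matrices R of interest, so the
   conventions of powR at nonpositive bases play no role. *)
Definition is_Gamma (K : realType) (n : nat) (alpha : K) (R : 'M[K]_n)
    (mu : probability (n.-tuple K) K) : Prop :=
  mu [set y | forall j, 0 <= tnth y j] = 1%E /\
  forall t : 'rV[K]_n, (forall j, 0 <= t ord0 j) ->
    ('E_mu[fun y : n.-tuple K =>
             expR (- \sum_(j < n) t ord0 j * tnth y j)%R])%E =
    ((\det (1%:M + R *m diag_mx t)) `^ (- alpha))%:E.

(* A distribution on [0, +oo)^n is determined by its Laplace transform, so at
   most one probability satisfies is_Gamma alpha R and the choice is immaterial.
   The value 0 is a dummy, for alpha and R admitting no such distribution. *)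
Definition Gamma_cdf (K : realType) (n : nat) (alpha : K) (x : 'I_n -> K)
    (R : 'M[K]_n) : K :=
  match pselect (exists mu, is_Gamma alpha R mu) with
  | left Gamma_ex =>
      fine (projT1 (cid Gamma_ex) [set y | forall j, tnth y j <= x j])
  | right _ => 0
  end.

(* Main.v *)
(* Write R_tau = R_0 + tau B and let m_J(tau) be the principal minors of R_tau, so
   that |I + R_tau T| = sum_J t^J m_J(tau). Differentiating the Laplace transform,
     d/dtau |I + R_tau T|^(-alpha)
       = alpha sum_J (- m_J'(tau)) t^J |I + R_tau T|^(-alpha - 1).
   At tau = 0, m_J' = m_J tr(R_{0,J}^-1 B_J) <= 0, because passing to a principal
   submatrix keeps the off-diagonal entries of the inverse nonpositive and B has
   zero diagonal; concavity of log det makes m_J' <= 0 for all tau >= 0.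

   The cdf is recovered without inverting Laplace transforms: the expectation of
   prod_j p(exp(- s_j Y_j)) is a finite linear combination of values of the Laplace
   transform, and p = 1 - (1 - X)^N with N = 2^m and s_j proportional to m approximates
   the indicator of a box. If p >= 0 is increasing on [0, 1],
   testing t^i (1 + e t)^(-c), i < c, against p(exp(- s y)) gives a nonnegative
   number (i = 1 is the derivative of a gamma density of shape c > 1). To reduce
   Gamma(alpha + 1, R_tau) to independent gamma laws, write R_tau = e I + A A^T; given
   a Wishart matrix, the coordinates are independent noncentral gamma variables, that
   is, Poisson mixtures of gamma laws. The lower bound from J = {i, j} with
   B_ij > 0 stays away from 0 as m tends to infinity, so the growth is strict.

   Existence of the laws is the same mixture for R = diag(r) + A A^T with A of rank
   n - 1 (which only needs 2 alpha > n - 2), the Wishart matrix being built one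
   row at a time from gamma and Gaussian variables (Bartlett). *)
From HB Require Import structures.
Require Import Defs.
From mathcomp Require Import all_boot all_order all_algebra all_fingroup.
From mathcomp Require Import all_classical all_reals all_analysis.
From mathcomp Require Import measurable_realfun ring lra.
From mathcomp Require Import simple_functions.
Import Order.TTheory GRing.Theory Num.Theory.
Import numFieldNormedType.Exports.
Set Implicit Arguments.
Unset Strict Implicit.
Unset Printing Implicit Defensive.
Local Open Scope classical_set_scope.
Local Open Scope ring_scope.

(** * Determinants and positive definite matrices *)

Section determinants.
Variable K : comUnitRingType.
Implicit Types (m n : nat).

Lemma det_schur m (c : 'M[K]_1) (u : 'M[K]_(1, m)) (w : 'cV[K]_m) N :
  N \in unitmx ->
  \det (block_mx c u w N : 'M[K]_(1 + m)) =
  (c 0 0 - (u *m invmx N *m w) 0 0) * \det N.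
Proof.
move=> Nu.
have -> : block_mx c u w N =
    block_mx 1%:M (u *m invmx N) 0 1%:M *m
    block_mx (c - u *m invmx N *m w) 0 w N :> 'M[K]_(1 + m).
  rewrite mulmx_block !mul1mx !mul0mx !add0r subrK -mulmxA mulVmx//.
  by rewrite mulmx1.
by rewrite det_mulmx det_ublock !det1 !mul1r det_lblock det_mx11 !mxE.
Qed.

(** Sylvester's identity: one block matrix is factored into triangular blocks in two ways. *)
Lemma det_mul_comm m n (A : 'M[K]_(m, n)) (B : 'M[K]_(n, m)) :
  \det (1%:M + A *m B) = \det (1%:M + B *m A).
Proof.
transitivity (\det (block_mx 1%:M (- A) B 1%:M)).
  have -> : block_mx 1%:M (- A) B 1%:M =
      block_mx 1%:M (- A) 0 1%:M *m block_mx (1%:M + A *m B) 0 B 1%:M.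
    rewrite mulmx_block ?mul1mx ?mul0mx ?mulmx0 ?add0r ?mulmx1.
    by rewrite mulNmx addrK.
  by rewrite det_mulmx det_ublock !det1 !mul1r det_lblock det1 mulr1.
have -> : block_mx 1%:M (- A) B 1%:M =
    block_mx 1%:M 0 B 1%:M *m block_mx 1%:M (- A) 0 (1%:M + B *m A).
  rewrite mulmx_block ?mul1mx ?mulmx1 ?mul0mx ?mulmx0 ?addr0.
  by rewrite mulmxN addrC addrK.
by rewrite det_mulmx det_lblock !det1 !mul1r det_ublock det1 mul1r.
Qed.

End determinants.

(** * Positive definite matrices: factorisation and bounds on quadratic forms *)

Section quadratic_forms.
Variable K : rcfType.
Implicit Types (m n : nat).

Definition qform n (M : 'M[K]_n) (v : 'cV[K]_n) : K := (v^T *m M *m v) 0 0.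

Definition sqnorm n (v : 'cV[K]_n) : K := (v^T *m v) 0 0.

Definition psdmx n (M : 'M[K]_n) := M^T = M /\ forall v, 0 <= qform M v.

Definition pdmx n (M : 'M[K]_n) :=
  M^T = M /\ forall v, v != 0 -> 0 < qform M v.

Lemma sqnormE n (v : 'cV[K]_n) : sqnorm v = \sum_i v i 0 ^+ 2.
Proof. by rewrite /sqnorm !mxE; apply: eq_bigr => i _; rewrite !mxE expr2. Qed.

Lemma sqnorm_ge0 n (v : 'cV[K]_n) : 0 <= sqnorm v.
Proof. by rewrite sqnormE sumr_ge0// => i _; rewrite sqr_ge0. Qed.

Lemma sqnorm_eq0 n (v : 'cV[K]_n) : (sqnorm v == 0) = (v == 0).
Proof.
apply/idP/eqP => [|->]; last by rewrite /sqnorm trmx0 mul0mx mxE.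
rewrite sqnormE psumr_eq0 => [/allP v0|i _]; last by rewrite sqr_ge0.
apply/matrixP => i j; rewrite ord1 mxE; apply/eqP.
by have := v0 i (mem_index_enum i); rewrite /= sqrf_eq0.
Qed.

Lemma sqnorm_gt0 n (v : 'cV[K]_n) : (0 < sqnorm v) = (v != 0).
Proof. by rewrite lt_def sqnorm_ge0 sqnorm_eq0 andbT. Qed.

Lemma qformD n (M N : 'M[K]_n) v : qform (M + N) v = qform M v + qform N v.
Proof. by rewrite /qform mulmxDr mulmxDl mxE. Qed.

Lemma qformZ n a (M : 'M[K]_n) v : qform (a *: M) v = a * qform M v.
Proof. by rewrite /qform -scalemxAr -scalemxAl mxE. Qed.

Lemma qform_scalar n a (v : 'cV[K]_n) : qform a%:M v = a * sqnorm v.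
Proof. by rewrite /qform mul_mx_scalar -scalemxAl mxE. Qed.

Lemma qform_conj m n (A : 'M[K]_(m, n)) (M : 'M[K]_m) v :
  qform (A^T *m M *m A) v = qform M (A *m v).
Proof. by rewrite /qform trmx_mul !mulmxA. Qed.

Lemma qform_gram m n (A : 'M[K]_(m, n)) v :
  qform (A *m A^T) v = sqnorm (A^T *m v).
Proof. by rewrite /qform /sqnorm trmx_mul trmxK !mulmxA. Qed.

Lemma qform_diag n (d : 'rV[K]_n) v :
  qform (diag_mx d) v = \sum_i d 0 i * v i 0 ^+ 2.
Proof.
rewrite /qform mul_mx_diag mxE; apply: eq_bigr => i _.
by rewrite !mxE; ring.
Qed.

Lemma psdmx_diag n (d : 'rV[K]_n) : (forall i, 0 <= d 0 i) -> psdmx (diag_mx d).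
Proof.
move=> d0; split; first exact: tr_diag_mx.
by move=> v; rewrite qform_diag sumr_ge0// => i _; rewrite mulr_ge0 ?sqr_ge0.
Qed.

Lemma psdmx_conj m n (A : 'M[K]_(m, n)) (M : 'M[K]_m) :
  psdmx M -> psdmx (A^T *m M *m A).
Proof.
move=> [MT M0]; split; first by rewrite !trmx_mul trmxK MT mulmxA.
by move=> v; rewrite qform_conj.
Qed.

Lemma pdmx1D n (M : 'M[K]_n) : psdmx M -> pdmx (1%:M + M).
Proof.
move=> [MT M0]; split; first by rewrite linearD/= MT trmx1.
by move=> v v0; rewrite qformD qform_scalar mul1r ltr_wpDr// sqnorm_gt0.
Qed.

Lemma pdmx_psd n (M : 'M[K]_n) : pdmx M -> psdmx M.
Proof.
move=> [MT M0]; split=> // v; have [->|v0] := eqVneq v 0; last exact/ltW/M0.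
by rewrite /qform trmx0 !mul0mx mxE.
Qed.

Lemma pdmx_unit n (M : 'M[K]_n) : pdmx M -> M \in unitmx.
Proof.
move=> [_ M0]; rewrite unitmxE unitfE; apply/negP => /det0P[v v0 vM].
have := M0 v^T; rewrite /qform trmxK vM mul0mx mxE ltxx => H.
by suff: false by []; apply: H; rewrite -trmx0 (inj_eq (@trmx_inj _ _ _)).
Qed.

(** If [qform M v = 0] and [w = M v] were nonzero, a step from [v] against [w] would make the form
    negative. So the form vanishes only on the kernel of [M]. *)
Lemma pdmx_unit_psd n (M : 'M[K]_n) : psdmx M -> M \in unitmx -> pdmx M.
Proof.
move=> [MT M0] Mu; split=> // v v0; rewrite lt_def M0 andbT.
apply/eqP => qv0; case/negP: v0; apply/eqP.
suff Mv : M *m v = 0 by rewrite -[v]mul1mx -(mulVmx Mu) -mulmxA Mv mulmx0.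
apply/eqP; rewrite -sqnorm_eq0 eq_le sqnorm_ge0 andbT leNgt; apply/negP => w0.
set w := M *m v in w0.
have qs s : qform M (v - s *: w) = - (2 * s * sqnorm w) + s ^+ 2 * qform M w.
  have -> : qform M (v - s *: w) = (v^T *m M *m v - s *: (v^T *m M *m w) -
      s *: (w^T *m M *m v) + s ^+ 2 *: (w^T *m M *m w)) 0 0.
    rewrite /qform [(v - _)^T]linearB/= linearZ/= !(mulmxBl, mulmxBr).
    rewrite -?scalemxAr -?scalemxAl -?scalemxAr -?scalemxAl ?scalerA -?expr2.
    by rewrite !mxE; ring.
  have -> : v^T *m M = w^T by rewrite /w trmx_mul MT.
  have -> : w^T *m M *m v = w^T *m w by rewrite -mulmxA.
  have -> : w^T *m v = v^T *m M *m v by rewrite /w trmx_mul MT.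
  rewrite !mxE; move: qv0; rewrite /qform !mxE => ->; rewrite /sqnorm !mxE.
  by ring.
have q0 := M0 w.
(* The minimising [s] would be [sqnorm w / qform M w]; the added 1 keeps the denominator positive
   and the value of the form negative. *)
have := M0 (v - (sqnorm w / (1 + qform M w)) *: w); rewrite qs leNgt => /negP; apply.
have d0 : 0 < 1 + qform M w by rewrite ltr_pwDl.
rewrite (_ : _ + _ = - (sqnorm w ^+ 2 * (2 + qform M w) / (1 + qform M w) ^+ 2)).
  by rewrite oppr_lt0 divr_gt0 ?mulr_gt0 ?exprn_gt0// ltr_pwDl.
by field; rewrite gt_eqF.
Qed.

Lemma qform_block m (c : 'M[K]_1) (u : 'M[K]_(1, m)) (w : 'cV[K]_m) M a v :
  qform (block_mx c u w M : 'M[K]_(1 + m)) (col_mx a v) =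
  a 0 0 ^+ 2 * c 0 0 + a 0 0 * (u *m v) 0 0 + a 0 0 * (v^T *m w) 0 0 + qform M v.
Proof.
rewrite /qform (tr_col_mx a v) mul_row_block mul_row_col !mulmxDl.
rewrite [a]mx11_scalar [c]mx11_scalar !tr_scalar_mx !mul_scalar_mx.
rewrite -!scalemxAl !mul_mx_scalar !mxE !eqxx/= !mulr1n.
by ring.
Qed.

Lemma pdmx_dr m (Q : 'M[K]_(1 + m)) : pdmx Q -> pdmx (drsubmx Q).
Proof.
move=> [QT Q0]; split; first by rewrite trmx_drsub QT.
move=> v v0; have := Q0 (col_mx 0 v); rewrite -[in qform Q](submxK Q).
rewrite qform_block mxE; have -> : forall a b c d : K,
   0 ^+ 2 * a + 0 * b + 0 * c + d = d by move=> *; ring.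
by apply; rewrite col_mx_eq0 negb_and v0 orbT.
Qed.

(** [A] has one column fewer than [Q], and the remainder is a single diagonal entry. This drives the
    induction for [cholesky]; used on its own, it lets the gamma law be built from a Wishart matrix
    of size [m] instead of [1 + m]. *)
Lemma cholesky_step m (Q : 'M[K]_(1 + m)) (B : 'M[K]_m) :
  pdmx Q -> drsubmx Q = B *m B^T ->
  exists (A : 'M[K]_(1 + m, m)) (s : K),
    [/\ 0 < s, drsubmx Q = dsubmx A *m (dsubmx A)^T &
        Q = A *m A^T + block_mx s%:M 0 0 0].
Proof.
move=> Qpd QB; have := pdmx_unit (pdmx_dr Qpd); rewrite QB => Bu.
have {}Bu : B \in unitmx by move: Bu; rewrite unitmx_mul => /andP[].
have BTu : B^T \in unitmx by rewrite unitmx_tr.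
have [QT Q0] := Qpd.
pose r : 'M[K]_(1, m) := ursubmx Q *m invmx B^T.
have rB : r *m B^T = ursubmx Q by rewrite /r mulmxKV.
pose s := (ulsubmx Q - r *m r^T) 0 0.
exists (col_mx r B), s.
have E : Q = col_mx r B *m (col_mx r B)^T + block_mx s%:M 0 0 0.
  rewrite tr_col_mx mul_col_row add_block_mx !addr0 rB -QB.
  have -> : B *m r^T = dlsubmx Q.
    by rewrite -[B]trmxK -trmx_mul rB trmx_ursub QT.
  by rewrite -[_%:M]mx11_scalar addrC subrK submxK.
split=> //; last by rewrite col_mxKd.
(* On the vector [(1, - y)] the Gram part vanishes, so positive definiteness of [Q] yields the sign
   of the Schur complement [s]. *)
pose y := invmx B^T *m r^T.
have := Q0 (col_mx 1%:M (- y)); rewrite {1}E qformD qform_gram.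
rewrite tr_col_mx mul_row_col mulmx1 mulmxN {}/y mulKVmx// subrr.
rewrite qform_block !mul0mx mulmx0 /sqnorm trmx0 mul0mx.
rewrite /qform mulmx0 mul0mx ![(0 : 'M[K]_1) _ _]mxE ![(_%:M) _ _]mxE eqxx !mulr1n.
rewrite expr1n !mulr0 mul1r !addr0 add0r; apply.
by rewrite col_mx_eq0 negb_and oner_eq0.
Qed.

Lemma cholesky n (Q : 'M[K]_n) : pdmx Q -> exists B : 'M[K]_n, Q = B *m B^T.
Proof.
elim: n Q => [|m IH] Q Qpd; first by exists 0; apply/matrixP => -[].
have [B QB] := IH _ (@pdmx_dr m Q Qpd).
have [A [s [s0 _ QA]]] := cholesky_step Qpd QB.
suff [B' QB'] : exists B' : 'M[K]_(1 + m), Q = B' *m B'^T by exists B'.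
exists (row_mx (col_mx (Num.sqrt s)%:M 0) A : 'M[K]_(1 + m)).
rewrite tr_row_mx mul_row_col tr_col_mx mul_col_row trmx0 !mulmx0 !mul0mx.
rewrite {1}QA addrC; congr (_ + _).
by rewrite tr_scalar_mx -scalar_mxM -expr2 sqr_sqrtr ?ltW.
Qed.

Lemma pdmx_det_gt0 n (Q : 'M[K]_n) : pdmx Q -> 0 < \det Q.
Proof.
move=> Qpd; have := pdmx_unit Qpd; have [B ->] := cholesky Qpd.
rewrite unitmxE unitfE det_mulmx det_tr -expr2 => d0.
by rewrite lt_def d0 sqr_ge0.
Qed.

Lemma sqr_sum_le n (y : 'I_n -> K) :
  (\sum_i y i) ^+ 2 <= n%:R * \sum_i y i ^+ 2.
Proof.
have : 0 <= \sum_i \sum_j (y i - y j) ^+ 2.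
  by apply: sumr_ge0 => i _; apply: sumr_ge0 => j _; exact: sqr_ge0.
suff -> : \sum_i \sum_j (y i - y j) ^+ 2 =
    2 * (n%:R * \sum_i y i ^+ 2 - (\sum_i y i) ^+ 2).
  by rewrite pmulr_rge0// subr_ge0.
transitivity (\sum_i (n%:R * y i ^+ 2 + \sum_j y j ^+ 2 - 2 * (y i * \sum_j y j))).
  apply: eq_bigr => i _; rewrite mulr_sumr mulr_sumr.
  have -> : n%:R * y i ^+ 2 = \sum_(j < n) y i ^+ 2.
    by rewrite sumr_const card_ord mulr_natl.
  by rewrite -big_split -sumrB/=; apply: eq_bigr => j _; ring.
rewrite sumrB big_split/= -!mulr_sumr -mulr_suml sumr_const card_ord.
by rewrite -mulr_natl; ring.
Qed.

Lemma sqnorm_mul_le m n (X : 'M[K]_(m, n)) (w : 'cV[K]_n) :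
  sqnorm (X *m w) <= n%:R * (\sum_i \sum_j X i j ^+ 2) * sqnorm w.
Proof.
rewrite [sqnorm (X *m w)]sqnormE mulr_sumr mulr_suml; apply: ler_sum => i _.
rewrite mxE; apply: le_trans (sqr_sum_le _) _.
rewrite -mulrA ler_wpM2l ?ler0n// sqnormE mulr_suml; apply: ler_sum => j _.
rewrite exprMn ler_wpM2l ?sqr_ge0//.
by rewrite (bigD1 j)//= lerDl sumr_ge0// => k _; rewrite sqr_ge0.
Qed.

(** A lower bound for the smallest eigenvalue without spectral theory: with [Q = B B^T] and [X] the
    inverse of [B^T], writing [v = X (B^T v)] bounds [sqnorm v] by a multiple of [qform Q v]. *)
Lemma pdmx_sub_scalar n (Q : 'M[K]_n) : pdmx Q ->
  exists e, 0 < e /\ forall d, d <= e -> pdmx (Q - d%:M).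
Proof.
move=> Qpd; have := pdmx_unit Qpd; have [QT _] := Qpd.
have [B QB] := cholesky Qpd; rewrite {1}QB unitmx_mul => /andP[_ Bu].
set X := invmx B^T.
pose C := n%:R * (\sum_i \sum_j X i j ^+ 2).
have C0 : 0 <= C.
  rewrite mulr_ge0 ?ler0n//; apply: sumr_ge0 => i _; apply: sumr_ge0 => j _.
  exact: sqr_ge0.
exists (1 + C)^-1; split; first by rewrite invr_gt0 ltr_pwDl.
move=> d dC; split; first by rewrite linearB/= QT tr_scalar_mx.
move=> v v0; rewrite qformD QB qform_gram -scalemx1 -scaleNr qformZ qform_scalar.
rewrite mul1r mulNr subr_gt0.
have : sqnorm v <= C * sqnorm (B^T *m v).
  by rewrite -{1}(mulKmx Bu v); exact: sqnorm_mul_le.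
have v0' : 0 < sqnorm v by rewrite sqnorm_gt0.
move=> H; have : d * sqnorm v <= (1 + C)^-1 * sqnorm v by rewrite ler_pM2r.
move=> /le_lt_trans; apply; rewrite mulrC ltr_pdivrMr ?ltr_pwDl//.
rewrite mulrDr mulr1 [sqnorm (B^T *m v) * C]mulrC; apply: le_lt_trans H _.
rewrite ltrDr sqnorm_gt0; apply: contraNN v0 => /eqP BTv.
by rewrite -(mulKmx Bu v) BTv mulmx0.
Qed.

Lemma pdmx_convex n (P Q : 'M[K]_n) t : pdmx P -> pdmx Q -> 0 <= t <= 1 ->
  pdmx (P + t *: (Q - P)).
Proof.
move=> [PT P0] [QT Q0] /andP[t0 t1]; split.
  by rewrite linearD/= linearZ/= linearB/= PT QT.
move=> v v0; rewrite (_ : P + _ = (1 - t) *: P + t *: Q); last first.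
  by rewrite scalerBl scalerBr scale1r addrAC addrA.
rewrite qformD !qformZ; move: (P0 v v0) (Q0 v v0) => {P0 Q0} P0 Q0.
have [->|tn0] := eqVneq t 0; first by rewrite subr0 mul1r mul0r addr0; exact: P0.
apply: ltr_wpDl; first by apply: mulr_ge0; [rewrite subr_ge0|exact: ltW].
by rewrite mulr_gt0 ?P0 ?Q0 1?lt_def ?tn0 ?t0.
Qed.

End quadratic_forms.

(** * Principal minors and the expansion of [\det (1 + A T)] *)

Section principal_minors.
Variable K : comUnitRingType.

(* [selmx J A] has the same determinant as the principal submatrix of A with
   index set J, but keeps the size of A. *)
Definition selmx n (J : {set 'I_n}) (A : 'M[K]_n) : 'M[K]_n :=
  \matrix_(i, j) if (i \in J) && (j \in J) then A i j else (i == j)%:R.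

(** The direction in which [selmx J] moves along a line: outside [J] the identity part is constant,
    whence the 0. *)
Definition restrmx n (J : {set 'I_n}) (A : 'M[K]_n) : 'M[K]_n :=
  \matrix_(i, j) if (i \in J) && (j \in J) then A i j else 0.

(** Leibniz expansion: distributing each product over [i] selects the set [J] of rows in which the
    entry of [A T] is taken, and the terms are regrouped by [J]. *)
Lemma det_one_add_mul_diag n (A : 'M[K]_n) (t : 'rV[K]_n) :
  \det (1%:M + A *m diag_mx t) =
  \sum_(J : {set 'I_n}) (\prod_(j in J) t 0 j) * \det (selmx J A).
Proof.
under [RHS]eq_bigr do rewrite mulr_sumr.
rewrite exchange_big; apply: eq_bigr => s _ /=.
under eq_bigr do rewrite mxE addrC mul_mx_diag 2!mxE.
rewrite bigA_distr mulr_sumr; apply: eq_bigr => J _.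
rewrite mulrCA; congr (_ * _).
(* If [s] moves an index outside [J], both sides vanish; otherwise [s] permutes [J], so the factors
   [t] can be reindexed by [s]. *)
have [sJ|sJ] := boolP [forall (i | i \notin J), s i == i]; last first.
  move: sJ; rewrite negb_forall => /existsP[i].
  rewrite negb_imply => /andP[iJ si].
  rewrite [LHS](bigD1 i)//= (negbTE iJ) eq_sym (negbTE si) mul0r.
  rewrite [X in _ = _ * X](bigD1 i)//= [X in _ * (X * _)]mxE (negbTE iJ)/= eq_sym (negbTE si).
  by rewrite mul0r mulr0.
have sJ' i : i \notin J -> s i = i by move=> iJ; apply/eqP/(implyP (forallP sJ i)).
have sinJ i : (s i \in J) = (i \in J).
  apply/idP/idP; last by apply: contraTT => /[dup] siJ /sJ'/perm_inj <-.
  by apply: contraTT => /[dup] iJ /sJ' ->.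
have -> : \prod_(j in J) t 0 j = \prod_i if i \in J then t 0 (s i) else 1.
  rewrite (reindex_inj (@perm_inj _ s))/= -big_mkcond/=.
  by apply: eq_bigl => i; rewrite sinJ.
rewrite -big_split/=; apply: eq_bigr => i _.
by rewrite mxE sinJ andbb; case: ifPn => _; rewrite ?mul1r// mulrC.
Qed.

(** The matrix is the identity plus a product through dimension 2, and Sylvester's identity reduces
    it to a 2 by 2 determinant. *)
Lemma det_selmx2 n (A : 'M[K]_n) (i j : 'I_n) : i != j ->
  A i i = 1 -> A j j = 1 ->
  \det (selmx [set i; j] A) = 1 - A i j * A j i.
Proof.
move=> ij Ai Aj.
pose P : 'M[K]_(n, 1 + 1) := row_mx (delta_mx i 0) (delta_mx j 0).
pose S : 'M[K]_(1 + 1, n) :=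
  col_mx (A i j *: delta_mx 0 j) (A j i *: delta_mx 0 i).
have -> : selmx [set i; j] A = 1%:M + P *m S.
  rewrite mul_row_col -!scalemxAr !mul_delta_mx; apply/matrixP => k l.
  rewrite !mxE !inE.
  have ij' := ij; rewrite eq_sym in ij'.
  case: (altP (k =P i)) => [->|ki]; case: (altP (l =P i)) => [->|li];
    rewrite ?eqxx ?(negbTE ij) ?(negbTE ij') ?(negbTE ki) ?(negbTE li) ?Ai /=;
    rewrite ?mulr0 ?mulr1 ?addr0 //.
  - rewrite [i == l]eq_sym (negbTE li) add0r.
    by case: (altP (l =P j)) => [->|lj]; rewrite ?mulr1 ?mulr0.
  - case: (altP (k =P j)) => [->|kj]; rewrite ?mulr0 ?addr0 ?mulr1 //=.
    by rewrite ?(negbTE ij) ?(negbTE ij') ?add0r.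
  - case: (altP (k =P j)) => [->|kj]; rewrite ?mulr0 ?addr0 //=.
    by case: (altP (l =P j)) => [->|lj]; rewrite ?eqxx ?Aj// [j == l]eq_sym (negbTE lj).
rewrite det_mul_comm mul_col_row -!scalemxAl !mul_delta_mx_cond eqxx.
rewrite eq_sym (negbTE ij) !mulr0n !mulr1n !scaler0.
rewrite [1%:M]scalar_mx_block add_block_mx !add0r !addr0 det_schur ?unitmx1//.
rewrite det1 mulr1 invmx1 mulmx1 !mxE big_ord1 !mxE !eqxx !mulr1n.
by rewrite mxE !eqxx !mulr1.
Qed.

End principal_minors.

(** * Derivatives of principal minors along a segment *)

Section minor_polynomials.
Variable K : rcfType.
Implicit Types (n : nat).

(** The pencil [A + X B] has polynomial entries, so that minors along the segment are polynomials
    and can be differentiated formally. *)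
Definition linpmx n (A B : 'M[K]_n) : 'M[{poly K}]_n :=
  map_mx polyC A + 'X *: map_mx polyC B.

Lemma horner_det_linpmx n (A B : 'M[K]_n) s :
  (\det (linpmx A B)).[s] = \det (A + s *: B).
Proof.
rewrite -[LHS]/(horner_eval s _) -det_map_mx; congr (\det _).
by apply/matrixP => i j; rewrite /linpmx !mxE/= ?horner_evalE ?hornerE.
Qed.

Lemma selmx_linp n (J : {set 'I_n}) (A B : 'M[K]_n) :
  selmx J (linpmx A B) = linpmx (selmx J A) (restrmx J B).
Proof.
apply/matrixP => i j; rewrite /linpmx !mxE; case: ifP => //= _.
by rewrite polyC0 mulr0 addr0; case: eqP.
Qed.

Lemma selmxD n (J : {set 'I_n}) (A B : 'M[K]_n) s :
  selmx J (A + s *: B) = selmx J A + s *: restrmx J B.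
Proof.
by apply/matrixP => i j; rewrite !mxE; case: ifP => //= _; rewrite mulr0 addr0.
Qed.

(** In the expansion over [J] the term of [J] carries [X ^ #|J|]; only singletons contribute to the
    linear coefficient. *)
Lemma deriv0_det_one_addX n (B : 'M[K]_n) :
  (\det (1%:M + map_mx polyC B *m diag_mx (const_mx 'X)))^`().[0] = \tr B.
Proof.
rewrite det_one_add_mul_diag raddf_sum horner_sum.
transitivity (\sum_(J : {set 'I_n} | #|J| == 1%N) \det (selmx J B)).
  rewrite [RHS]big_mkcond; apply: eq_bigr => J _.
  have -> : \det (selmx J (map_mx polyC B)) = (\det (selmx J B))%:P.
    rewrite -det_map_mx; congr (\det _); apply/matrixP => i j.
    by rewrite !mxE; case: ifP => // _; case: eqP.
  under eq_bigr do rewrite mxE.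
  rewrite prodr_const mulrC mul_polyC /= derivZ derivXn hornerZ hornerMn hornerXn.
   case: #|J| => [|[|k]] /=; rewrite ?expr0 ?mulr1 ?mulr0n ?mulr0//.
  by rewrite expr0n mul0rn mulr0.
rewrite /mxtrace (eq_bigl (fun J : {set 'I_n} => J \in ((@finset.set1 'I_n) @: 'I_n)%SET)); last first.
  move=> J; apply/cards1P/imsetP => [[i ->]|[i _ ->]]; last by exists i.
  by exists i.
rewrite big_imset/=; last by move=> i j _ _ /set1_inj.
apply: eq_bigr => i _.
have -> : selmx [set i] B = diag_mx (\row_k if k == i then B i i else 1).
  apply/matrixP => k l; rewrite !mxE !inE.
  have [->|kl] := eqVneq k l; first by case: eqP => [->|]; rewrite mulr1n.
  have [ki|] := eqVneq k i; last by rewrite mulr0n.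
  by rewrite -ki eq_sym (negbTE kl) mulr0n.
rewrite det_diag (bigD1 i)//= mxE eqxx big1 ?mulr1// => k ki.
by rewrite mxE (negbTE ki).
Qed.

(** Jacobi's formula: after the shift [X + s] the matrix [C] is factored out, which leaves the
    derivative of [\det (1 + X C^-1 B)] at 0. *)
Lemma deriv_det_linpmx n (A B : 'M[K]_n) s :
  A + s *: B \in unitmx ->
  (\det (linpmx A B))^`().[s] =
  \det (A + s *: B) * \tr (invmx (A + s *: B) *m B).
Proof.
set C := A + s *: B => Cu.
have E : \det (linpmx A B) \Po ('X + s%:P) =
    (\det C)%:P * \det (1%:M + map_mx polyC (invmx C *m B) *m diag_mx (const_mx 'X)).
  have -> : (\det C)%:P = \det (map_mx polyC C) by rewrite det_map_mx.
  rewrite -det_mulmx -[LHS]/(comp_poly ('X + s%:P) _) -det_map_mx.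
  congr (\det _); rewrite mulmxDr mulmx1 mulmxA -map_mxM/= mulKVmx//.
  rewrite mul_mx_diag; apply/matrixP => i j.
  rewrite !mxE/= comp_polyD comp_polyM comp_polyX !comp_polyC.
  by rewrite polyCD polyCM; ring.
have := congr1 (fun p => p^`().[0]) E.
rewrite deriv_comp derivD derivX derivC addr0 mulr1 horner_comp !hornerE ?add0r => ->.
by rewrite derivM derivC mul0r add0r hornerM hornerC deriv0_det_one_addX.
Qed.

Lemma trace_gram_ge0 m n (A : 'M[K]_(m, n)) : 0 <= \tr (A *m A^T).
Proof.
apply: sumr_ge0 => i _; rewrite mxE; apply: sumr_ge0 => j _.
by rewrite mxE -expr2 sqr_ge0.
Qed.

Lemma pdmx_inv_gram n (A : 'M[K]_n) : pdmx A ->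
  exists P : 'M[K]_n, invmx A = P *m P^T.
Proof.
move=> Apd; have := pdmx_unit Apd; have [B ->] := cholesky Apd.
move=> BBu; have := BBu; rewrite unitmx_mul => /andP[Bu BTu].
exists (invmx B^T); rewrite trmx_inv trmxK.
apply: (can_inj (mulKmx BBu)); rewrite mulmxV// mulmxA -[B *m B^T *m _]mulmxA.
by rewrite mulmxV// mulmx1 mulmxV.
Qed.

(* Concavity of log det along a segment of positive definite matrices. *)
Lemma trace_inv_mul_le n (A B : 'M[K]_n) s : B^T = B -> 0 <= s ->
  pdmx A -> pdmx (A + s *: B) ->
  \tr (invmx (A + s *: B) *m B) <= \tr (invmx A *m B).
Proof.
move=> BT s0 Apd Cpd; set C := A + s *: B in Cpd *.
have Au := pdmx_unit Apd; have Cu := pdmx_unit Cpd.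
have [P AP] := pdmx_inv_gram Apd; have [S CS] := pdmx_inv_gram Cpd.
(* The resolvent identity. Multiplied by [B], its trace becomes by cyclicity [s] times the trace of
   a Gram matrix. *)
have E : invmx A - invmx C = s *: (invmx A *m B *m invmx C).
  have -> : s *: (invmx A *m B *m invmx C) = invmx A *m (C - A) *m invmx C.
    have -> : C - A = s *: B by rewrite /C addrC addKr.
    by rewrite -scalemxAr -scalemxAl.
  by rewrite mulmxBr mulmxBl mulVmx// mul1mx -mulmxA mulmxV// mulmx1.
rewrite -subr_ge0 -raddfB/= -mulmxBl E -scalemxAl mxtraceZ mulr_ge0// AP CS.
have -> : P *m P^T *m B *m (S *m S^T) *m B = P *m (P^T *m B *m S *m S^T *m B).
  by rewrite !mulmxA.
rewrite mxtrace_mulC.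
have -> : P^T *m B *m S *m S^T *m B *m P = (P^T *m B *m S) *m (P^T *m B *m S)^T.
  by rewrite !trmx_mul trmxK BT !mulmxA.
exact: trace_gram_ge0.
Qed.

Lemma qform_selmx n (J : {set 'I_n}) (Q : 'M[K]_n) v :
  qform (selmx J Q) v =
  qform Q (\col_i if i \in J then v i 0 else 0) +
  \sum_(i | i \notin J) v i 0 ^+ 2.
Proof.
have qformE (M : 'M[K]_n) w : qform M w = \sum_i \sum_j w i 0 * M i j * w j 0.
  rewrite /qform -mulmxA mxE; apply: eq_bigr => i _; rewrite !mxE mulr_sumr.
  by apply: eq_bigr => j _; rewrite mulrA.
rewrite !qformE [X in _ = _ + X]big_mkcond -big_split/=.
apply: eq_bigr => i _; case: ifPn => iJ.
  rewrite (bigD1 i)//= !mxE (negbTE iJ)/= eqxx mulr1 big1 ?addr0.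
    rewrite big1 ?add0r ?expr2// => j _.
    by rewrite ?mxE ?(negbTE iJ) !mul0r.
  by move=> j ji; rewrite mxE (negbTE iJ)/= eq_sym (negbTE ji) mulr0 mul0r.
rewrite negbK in iJ; rewrite addr0; apply: eq_bigr => j _; rewrite !mxE iJ/=.
case: ifPn => // jJ; have [ij|_] := eqVneq i j; last by rewrite !mulr0 mul0r.
by rewrite -ij iJ in jJ.
Qed.

Lemma pdmx_selmx n (J : {set 'I_n}) (Q : 'M[K]_n) :
  pdmx Q -> pdmx (selmx J Q).
Proof.
move=> Qpd; have [QT Q0] := Qpd; have [_ Q0'] := pdmx_psd Qpd; split.
  apply/matrixP => i j; rewrite !mxE andbC; case: ifP => _; last by rewrite eq_sym.
  by rewrite -[in RHS]QT mxE.
move=> v v0; rewrite qform_selmx.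
set w := (\col_i _ : 'cV[K]_n); have [w0|w0] := eqVneq w 0; last first.
  by apply: ltr_wpDr; [apply: sumr_ge0 => i _; exact: sqr_ge0|exact: Q0].
apply: ltr_wpDl; first exact: Q0'.
suff -> : \sum_(i | i \notin J) v i 0 ^+ 2 = sqnorm v by rewrite sqnorm_gt0.
rewrite sqnormE [RHS](bigID (mem J))/= [X in _ = X + _]big1 ?add0r// => i iJ.
by have /matrixP/(_ i 0) := w0; rewrite !mxE iJ => ->; rewrite expr0n.
Qed.

(* The inverse of [selmx [set~ k] Q] is a Schur complement of [invmx Q], whose
   off-diagonal entries are at most those of [invmx Q]. *)
Lemma invmx_selmx_setC1 n (k : 'I_n) (Q : 'M[K]_n) : pdmx Q ->
  invmx (selmx [set~ k] Q) =
  selmx [set~ k] (\matrix_(i, j)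
    (invmx Q i j - invmx Q i k * invmx Q k j / invmx Q k k)).
Proof.
move=> Qpd; have Qu := pdmx_unit Qpd.
have Su := pdmx_unit (pdmx_selmx [set~ k] Qpd).
have [P QP] := pdmx_inv_gram Qpd.
have kk0 : invmx Q k k != 0.
  apply/negP => /eqP; rewrite QP mxE => /eqP.
  under eq_bigr do rewrite mxE -expr2.
  rewrite psumr_eq0 => [/allP P0|i _]; last exact: sqr_ge0.
  have : row k (invmx Q) = 0.
    apply/rowP => j; rewrite QP mxE mxE mxE big1// => i _.
    by have := P0 i (mem_index_enum i); rewrite /= sqrf_eq0 => /eqP ->; rewrite mul0r.
  rewrite rowE => /(congr1 (mulmxr Q)); rewrite /= mulmxKV// mul0mx.
  by move/matrixP/(_ 0 k); rewrite !mxE !eqxx => /eqP; rewrite oner_eq0.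
have QV i j : \sum_l Q i l * invmx Q l j = (i == j)%:R.
  by have /matrixP/(_ i j) := mulmxV Qu; rewrite !mxE.
apply: (can_inj (mulKmx Su)); rewrite mulmxV//; apply/esym/matrixP => i j.
rewrite !mxE; have [->|ik] := eqVneq i k.
  rewrite (bigD1 k)//= big1 => [|l lk]; last first.
    by rewrite !mxE !inE eqxx/= eq_sym (negbTE lk) mul0r.
  by rewrite !mxE !inE eqxx/= mul1r addr0.
have [->|jk] := eqVneq j k.
  rewrite big1 ?(negbTE ik)// => l _.
  rewrite !mxE !inE ik eqxx andbF /=; have [->|lk] := eqVneq l k; last by rewrite mulr0.
  by rewrite (negbTE ik) mul0r.
transitivity (\sum_(l | l != k) Q i l *
    (invmx Q l j - invmx Q l k * invmx Q k j / invmx Q k k)).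
  rewrite (bigD1 k)//= !mxE !inE ik eqxx /= (negbTE ik) mul0r add0r.
  by apply: eq_bigr => l lk; rewrite !mxE !inE ik jk lk.
have := QV i j; have := QV i k; rewrite (negbTE ik).
rewrite (bigD1 k)//= [X in _ -> X = _ -> _](bigD1 k)//=.
set S1 := \sum_(_ | _) _; set S2 := \sum_(_ | _) _ => e1 e2.
transitivity (S2 - S1 * (invmx Q k j / invmx Q k k)).
  by rewrite mulr_suml -sumrB; apply: eq_bigr => l _; ring.
have -> : S1 = - (Q i k * invmx Q k k).
  by apply/eqP; rewrite -subr_eq0 opprK addrC e1.
by rewrite -e2; field.
Qed.

(** For positive definite [Q] this makes [Q] an M-matrix; it is applied to inverses. *)
Definition offdiag_le0 n (Q : 'M[K]_n) := forall i j, i != j -> Q i j <= 0.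

Lemma selmxT n (Q : 'M[K]_n) : selmx [set: 'I_n]%SET Q = Q.
Proof. by apply/matrixP => i j; rewrite !mxE !inE. Qed.

Lemma selmx_selmx n (I J : {set 'I_n}) (Q : 'M[K]_n) :
  selmx I (selmx J Q) = selmx (I :&: J)%SET Q.
Proof.
apply/matrixP => i j; rewrite !mxE !inE.
by do 4 case: (_ \in _).
Qed.

(** The Schur correction subtracts a product of two nonpositive entries divided by a nonnegative
    diagonal entry, so off-diagonal entries can only decrease. *)
Lemma offdiag_le0_selmx_setC1 n (k : 'I_n) (Q : 'M[K]_n) :
  pdmx Q -> offdiag_le0 (invmx Q) -> offdiag_le0 (invmx (selmx [set~ k] Q)).
Proof.
move=> Qpd Qle i j ij; rewrite invmx_selmx_setC1// !mxE !inE (negbTE ij).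
case: ifP => // /andP[ik jk].
apply: le_trans (Qle _ _ ij); rewrite gerDl oppr_le0 divr_ge0//.
  by rewrite mulr_le0 ?Qle// eq_sym.
have [P ->] := pdmx_inv_gram Qpd.
by rewrite mxE; apply: sumr_ge0 => l _; rewrite mxE -expr2 sqr_ge0.
Qed.

(** Indices outside [J] are removed one at a time, by induction on the size of the complement. *)
Lemma offdiag_le0_selmx n (J : {set 'I_n}) (Q : 'M[K]_n) :
  pdmx Q -> offdiag_le0 (invmx Q) -> offdiag_le0 (invmx (selmx J Q)).
Proof.
move=> Qpd Qle; have [m] := ubnP #|~: J|; elim: m J => // m IH J Jm.
have [/eqP|/set0Pn[k kJ]] := boolP (~: J == finset.set0)%SET.
  by rewrite -finset.setCT => /finset.setC_inj ->; rewrite selmxT.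
rewrite inE in kJ; have -> : J = ([set~ k] :&: (k |: J))%SET.
  by apply/setP => l; rewrite !inE; case: eqP => // ->; rewrite (negbTE kJ).
rewrite -selmx_selmx; apply: offdiag_le0_selmx_setC1; first exact: pdmx_selmx.
apply: IH; move: Jm; rewrite (cardsD1 k (~: J)) !inE kJ add1n !ltnS.
apply: leq_ltn_trans; apply: subset_leq_card.
by apply/fintype.subsetP => l; rewrite !inE negb_or.
Qed.

(* Removing indices preserves nonpositivity of the off-diagonal entries of the
   inverse, which gives the sign at s = 0; concavity of log det propagates it. *)
Lemma deriv_minor_le0 n (J : {set 'I_n}) (A B : 'M[K]_n) s :
  pdmx A -> offdiag_le0 (invmx A) -> B^T = B ->
  (forall i, B i i = 0) -> (forall i j, 0 <= B i j) -> 0 <= s ->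
  pdmx (A + s *: B) -> (\det (selmx J (linpmx A B)))^`().[s] <= 0.
Proof.
move=> Apd Ale BT Bd B0 s0 Cpd; rewrite selmx_linp.
have Spd := pdmx_selmx J Cpd; rewrite selmxD in Spd.
have Apd' := pdmx_selmx J Apd.
rewrite deriv_det_linpmx; last exact: pdmx_unit.
rewrite pmulr_rle0; last exact: pdmx_det_gt0.
apply: le_trans (trace_inv_mul_le _ s0 Apd' Spd) _.
  by apply/matrixP => i j; rewrite !mxE andbC -[in LHS]BT mxE.
rewrite /mxtrace sumr_le0// => i _; rewrite mxE sumr_le0// => j _.
rewrite mxE; case: ifP => _; last by rewrite mulr0.
have [->|ij] := eqVneq j i; first by rewrite Bd mulr0.
rewrite mulr_le0_ge0// offdiag_le0_selmx//.
by rewrite eq_sym.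
Qed.

(** The minor is [1 - (A i j + s * B i j) ^+ 2]. Strictness comes from here: for [s >= 0] the
    derivative is bounded away from 0 as soon as [A i j] and [B i j] are positive. *)
Lemma deriv_minor2 n (A B : 'M[K]_n) i j s : i != j ->
  A i i = 1 -> A j j = 1 -> A^T = A -> B i i = 0 -> B j j = 0 -> B^T = B ->
  (\det (selmx [set i; j] (linpmx A B)))^`().[s] =
  - (2 * (A i j + s * B i j) * B i j).
Proof.
move=> ij Ai Aj AT Bi Bj BT; rewrite det_selmx2//; last 2 first.
- by rewrite /linpmx !mxE Ai Bi polyC0 mulr0 addr0.
- by rewrite /linpmx !mxE Aj Bj polyC0 mulr0 addr0.
have Aji : A j i = A i j by rewrite -[in LHS]AT mxE.
have Bji : B j i = B i j by rewrite -[in LHS]BT mxE.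
rewrite /linpmx !mxE Aji Bji derivB derivM derivD derivM derivX -polyC1 !derivC.
by rewrite !(hornerE, hornerD, hornerM); ring.
Qed.

End minor_polynomials.

(** * Existence of the multivariate gamma law *)

Section density.
Local Open Scope ereal_scope.
Context d (T : measurableType d) (K : realType).
Variables (m : {measure set T -> \bar K}) (W : T -> K).
Hypotheses (mW : measurable_fun setT W) (W0 : forall x, (0 <= W x)%R).

(** The proofs of nonnegativity and measurability are arguments so that the measure structure below
    can be attached to the term itself. *)
Definition mdensity of (forall x, (0 <= W x)%R) & measurable_fun setT W :=
  fun A : set T => \int[m]_(x in A) (W x)%:E.

Local Notation nu := (mdensity W0 mW).

Let nu0 : nu set0 = 0.
Proof. exact: integral_set0. Qed.

Let nu_ge0 A : 0 <= nu A.
Proof. by apply: integral_ge0 => x _; rewrite lee_fin W0. Qed.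

Let nu_additive : semi_sigma_additive nu.
Proof.
move=> /= A mA tA mUA; rewrite /mdensity ge0_integral_bigcup//; last 2 first.
- by apply/measurable_EFinP; exact: measurable_funTS.
- by move=> x _; rewrite lee_fin.
apply: is_cvg_ereal_nneg_natsum_cond => n _ _.
by apply: integral_ge0 => x _; rewrite lee_fin.
Qed.

HB.instance Definition _ := isMeasure.Build _ _ _
  nu nu0 nu_ge0 nu_additive.

Import HBNNSimple.

Let integral_nu_nnsfun (h : {nnsfun T >-> K}) :
  \int[nu]_x (h x)%:E = \int[m]_x ((h x)%:E * (W x)%:E).
Proof.
rewrite integralT_nnsfun sintegralE.
transitivity (\int[m]_x (\sum_(y \in range h)
    (y%:E * ((W x)%:E * (\1_(h @^-1` [set y]) x)%:E)))); last first.
  apply: eq_integral => x _; rewrite (fimfunE h x) -fsumEFin//.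
  rewrite ge0_mule_fsuml => [|y]; last exact: nnfun_muleindic_ge0.
  by apply: eq_fsbigr => y _; rewrite EFinM -muleA; congr (_ * _); rewrite muleC.
rewrite ge0_integral_fsum//; last 2 first.
- by move=> y; apply: measurable_funeM; apply: emeasurable_funM; exact/measurable_EFinP.
- by move=> y x _; rewrite muleCA mule_ge0 ?lee_fin//; exact: nnfun_muleindic_ge0.
apply: eq_fsbigr => y /[!inE] yh.
rewrite ge0_integralZl//; last 3 first.
- by apply: emeasurable_funM => //; exact/measurable_EFinP.
- by move=> x _; rewrite mule_ge0// lee_fin.
- by case: yh => x _ <-; rewrite lee_fin.
congr (_ * _); rewrite /= /mdensity integral_mkcond.
by apply: eq_integral => x _; rewrite epatch_indic.
Qed.

(** Simple functions first, then monotone convergence on both sides. *)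
Lemma integral_mdensity (f : T -> \bar K) :
  measurable_fun setT f -> (forall x, 0 <= f x) ->
  \int[nu]_x f x = \int[m]_x (f x * (W x)%:E).
Proof.
move=> mf f0; pose h := nnsfun_approx measurableT mf.
have hf x : (h n x)%:E @[n --> \oo] --> f x.
  exact: (cvg_nnsfun_approx measurableT mf).
have nd_h x : {homo (fun n => (h n x)%:E) : a b / (a <= b)%N >-> a <= b}.
  by move=> a b ab; rewrite lee_fin; exact/lefP/nd_nnsfun_approx.
transitivity (limn (fun n => \int[nu]_x (h n x)%:E)).
  rewrite -monotone_convergence//.
  - by apply: eq_integral => x _; apply/esym/cvg_lim => //; exact: hf.
  - by move=> n; exact/measurable_EFinP.
  - by move=> n x _; rewrite lee_fin.
transitivity (limn (fun n => \int[m]_x ((h n x)%:E * (W x)%:E))).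
  by congr (limn _); apply/funext => n; rewrite integral_nu_nnsfun.
rewrite -monotone_convergence//.
- apply: eq_integral => x _; apply/cvg_lim => //.
  by apply: cvgeZr => //; exact: hf.
- by move=> n; apply: emeasurable_funM; exact/measurable_EFinP.
- by move=> n x _; rewrite mule_ge0// lee_fin.
- by move=> x _ a b ab; rewrite lee_wpmul2r ?lee_fin//; exact: nd_h.
Qed.

End density.

Section mass_one.
Local Open Scope ereal_scope.
Context d (T : measurableType d) (K : realType).
Variables (m : {measure set T -> \bar K}) (m1 : m setT = 1).

(** An alias of [m] that carries the proof of total mass 1, so that the probability structure can be
    attached to it. *)
Definition mass_one of m setT = 1 : set T -> \bar K := m.

Local Notation P := (mass_one m1).

Let P0 : P set0 = 0. Proof. exact: measure0. Qed.

Let P_ge0 A : 0 <= P A. Proof. exact: measure_ge0. Qed.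

Let P_additive : semi_sigma_additive P.
Proof. exact: measure_semi_sigma_additive. Qed.

HB.instance Definition _ := isMeasure.Build _ _ _ P P0 P_ge0 P_additive.

HB.instance Definition _ := Measure_isProbability.Build _ _ _ P m1.

Lemma mass_one_probability :
  exists P : probability T K, forall f : T -> \bar K,
    \int[P]_x f x = \int[m]_x f x.
Proof.
exists (mass_one m1 : probability T K) => f.
by apply: eq_measure_integral.
Qed.

End mass_one.

Section measures_of_mass_one.
Local Open Scope ereal_scope.
Context (K : realType).

Lemma pushforward_probability d (T : measurableType d)
    (m : {measure set T -> \bar K}) d' (T' : measurableType d') (Y : T -> T') :
  measurable_fun setT Y -> m setT = 1 ->
  exists P : probability T' K, forall f : T' -> \bar K,
    measurable_fun setT f -> (forall x, 0 <= f x) ->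
    \int[P]_x f x = \int[m]_x f (Y x).
Proof.
move=> mY m1.
pose nu0 : {measure set T' -> \bar K} := pushforward m Y.
have nu1 : nu0 mY setT = 1 by rewrite /= /pushforward preimage_setT.
have [P Pnu] := mass_one_probability nu1.
by exists P => f mf f0; rewrite Pnu ge0_integral_pushforward.
Qed.

End measures_of_mass_one.

(** * One-dimensional gamma and normal laws *)

Section gamma_integral.
Context (K : realType).
Local Notation leb := (@lebesgue_measure K).

Definition stretched_exp (p v : K) := expR (- (v `^ p)).

Lemma measurable_stretched_exp p : measurable_fun setT (stretched_exp p).
Proof.
by apply: measurableT_comp => //; apply: measurableT_comp.
Qed.

Lemma continuous_stretched_exp p : 0 < p ->
  {within `[0, +oo[, continuous (stretched_exp p)}.
Proof.
move=> p0; apply/continuous_within_itvcyP; split.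
  move=> v; rewrite in_itv/= andbT => v0.
  apply: continuous_comp; last exact: continuous_expR.
  apply: continuousN; apply/differentiable_continuous/derivable1_diffP.
  by apply: derivable_powR; rewrite in_itv/= andbT.
rewrite /stretched_exp powR0 ?gt_eqF// oppr0.
apply: continuous_cvg; first exact: continuous_expR.
rewrite -[X in _ --> X]oppr0; apply: cvgN.
exact: powR_cvg0.
Qed.

(* [gammaJ p = Gamma (1 + p^-1)]: the substitution [y = v ^ p] turns the density
   [exp (- v ^ p)] into the gamma density of shape [p^-1] without a singularity
   at 0. *)
Definition gammaJ p : \bar K := (\int[leb]_(v in `[0%R, +oo[) (stretched_exp p v)%:E)%E.

Lemma stretched_exp_scale (p s : K) : 0 < p -> 0 < s ->
  (\int[leb]_(v in `[0%R, +oo[) (expR (- (s * v `^ p)))%:E =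
   (s `^ (- p^-1))%:E * gammaJ p)%E.
Proof.
move=> p0 s0; set r := s `^ p^-1.
have r0 : 0 < r by rewrite powR_gt0.
pose F (x : K) := r * x.
have dF (x : K) : is_derive x 1 F r.
  by rewrite /F; apply: is_derive_eq; rewrite scaler1.
have F'E : F^`()%classic = cst r by apply/funext => x; rewrite derive1E derive_val.
have sE v : 0 <= v -> stretched_exp p (F v) = expR (- (s * v `^ p)).
  move=> v0; rewrite /stretched_exp /F powRM ?(ltW r0)//.
  by rewrite /r -powRrM mulVf ?gt_eqF// powRr1// ltW.
have := @increasing_ge0_integration_by_substitutiony K F (stretched_exp p) 0.
rewrite F'E; have -> : F 0 = 0 by rewrite /F mulr0.
move=> H; rewrite /gammaJ H //; last first.
- by move=> x _; exact: expR_ge0.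
- exact: continuous_stretched_exp.
- by rewrite /F; apply: gt0_cvgMry => //; exact: cvg_id.
- split; first by move=> x _; exact: ex_derive.
  apply: cvg_at_right_filter; apply: differentiable_continuous.
  exact/derivable1_diffP/ex_derive.
- exact: is_cvg_cst.
- exact: is_cvg_cst.
- by move=> x _; exact: cvg_cst.
- by move=> x y _ _; rewrite ltr_pM2l.
rewrite -ge0_integralZl//=.
- apply: eq_integral => v; rewrite inE/= in_itv/= andbT => v0.
  rewrite -EFinM -[((_ \o _) * _) v]/(stretched_exp p (F v) * r) sE// powRN -/r.
  by rewrite mulrCA mulVf ?gt_eqF// mulr1.
- apply/measurable_EFinP/measurable_funM => //.
  apply: measurable_funTS; apply: measurableT_comp.
    exact: measurable_stretched_exp.
  exact: measurable_funM.
- by move=> x _; rewrite lee_fin mulr_ge0 ?expR_ge0 ?ltW.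
- by rewrite lee_fin powR_ge0.
Qed.

(** The integrand is dominated by a multiple of [1 / (1 + v^2)]: once [2 <= p n], every [v >= 1]
    satisfies [v^2 <= v^(p n) <= n^n exp(v^p)]. *)
Lemma gammaJ_lty (p : K) : 0 < p -> (gammaJ p < +oo)%E.
Proof.
move=> p0; have [n n0 pn] : exists2 n : nat, (0 < n)%N & 2 <= p * n%:R.
  exists (Num.bound (2 / p)).+1 => //.
  rewrite -ler_pdivrMl// mulrC; apply/ltW/(lt_trans (archi_boundP _)).
    by rewrite divr_ge0// ltW.
  by rewrite ltr_nat.
pose C : K := 2 * n%:R ^+ n.
have bnd v : 0 <= v -> stretched_exp p v <= C * (oneDsqr v)^-1.
  move=> v0; rewrite ler_pdivlMr ?oneDsqr_gt0// /oneDsqr.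
  have n1 : 1 <= n%:R ^+ n :> K by rewrite exprn_ege1// ler1n.
  have e1 : stretched_exp p v <= 1.
    by rewrite /stretched_exp expR_le1 oppr_le0 powR_ge0.
  have e0 : 0 <= stretched_exp p v by exact: expR_ge0.
  have [v1|v1] := leP v 1.
    apply: (@le_trans _ _ (1 * 2)); last by rewrite /C mul1r ler_peMr.
    apply: ler_pM => //; first by rewrite addr_ge0 ?sqr_ge0.
    have : v ^+ 2 <= 1 by rewrite expr_le1.
    by lra.
  have vp : v ^+ 2 <= n%:R ^+ n * expR (v `^ p).
    have -> : v `^ p = n%:R * (v `^ p / n%:R) by field; rewrite pnatr_eq0 -lt0n.
    rewrite expRM_natl -exprMn.
    apply: (@le_trans _ _ ((v `^ p) ^+ n)).
      rewrite -powR_mulrn ?powR_ge0// -powRrM -powR_mulrn//.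
      by apply: ler_powR => //; exact: ltW.
    rewrite lerXn2r ?nnegrE ?powR_ge0 ?mulr_ge0 ?expR_ge0//.
    rewrite -ler_pdivrMl ?ltr0n// mulrC.
    by apply: le_trans (expR_ge1Dx _); rewrite lerDr.
  rewrite /stretched_exp expRN mulrC ler_pdivrMr ?expR_gt0// /C.
  have : 1 <= v ^+ 2 by rewrite exprn_ege1// ltW.
  by lra.
have mV : measurable_fun setT (fun v : K => (oneDsqr v)^-1).
  by apply: continuous_measurable_fun; exact: continuous_oneDsqrV.
apply: (@le_lt_trans _ _
    (\int[leb]_(v in `[0%R, +oo[) (C%:E * ((oneDsqr v)^-1)%:E))%E).
  apply: ge0_le_integral => //.
  - by move=> v _; rewrite lee_fin expR_ge0.
  - apply/measurable_EFinP/measurable_funTS.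
    exact: measurable_stretched_exp.
  - apply/measurable_EFinP/measurable_funTS/measurable_funM => //.
  - by move=> v; rewrite /= in_itv/= andbT => v0; rewrite lee_fin bnd.
rewrite ge0_integralZl//.
- by rewrite integral0y_oneDsqr -EFinM ltry.
- exact/measurable_EFinP/measurable_funTS.
- by rewrite lee_fin mulr_ge0// exprn_ge0.
Qed.

Lemma stretched_exp_itv_gt0 (p y z : K) : 0 < p -> 0 <= y -> y < z ->
  (0 < \int[leb]_(v in `[y, z]) (stretched_exp p v)%:E)%E.
Proof.
move=> p0 y0 yz; apply: (@lt_le_trans _ _
    (\int[leb]_(v in `[y, z]) (expR (- (z `^ p)))%:E)%E).
  rewrite integral_cst//= lebesgue_measure_itv/= lte_fin yz -EFinB -EFinM.
  by rewrite lte_fin mulr_gt0 ?expR_gt0 ?subr_gt0.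
apply: ge0_le_integral => //.
- apply/measurable_EFinP/measurable_funTS.
  exact: measurable_stretched_exp.
- move=> v; rewrite /= in_itv/= => /andP[yv vz].
  rewrite lee_fin ler_expR lerN2 ge0_ler_powR ?nnegrE// ?(ltW p0)//.
    exact: le_trans yv.
  exact/ltW/(le_lt_trans y0).
Qed.

End gamma_integral.

Lemma measurable_expRN (K : realType) d (T : measurableType d) (X : T -> K) :
  measurable_fun setT X -> measurable_fun setT (fun x => expR (- X x)).
Proof. by move=> mX; apply: measurableT_comp => //; apply: measurableT_comp. Qed.

(** [X] is [v^p] with [p = 1 / a], under the normalised density [exp(- v^p)] on the half-line; the
    Laplace transform follows by scaling [v]. The positive mass of intervals feeds the later lower
    bounds on Laplace functionals. *)
Lemma gamma_law (K : realType) (a : K) : 0 < a ->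
  exists d (T : measurableType d) (P : probability T K) (X : T -> K),
  [/\ measurable_fun setT X, (forall v, 0 <= X v),
      (forall t, 0 <= t ->
        (\int[P]_v (expR (- (t * X v)))%:E)%E = ((1 + t) `^ (- a))%:E) &
      (forall y z, 0 <= y -> y < z -> (0 < P [set v | (y <= X v <= z)%R])%E)].
Proof.
move=> a0; pose p := a^-1; have p0 : 0 < p by rewrite invr_gt0.
pose leb := @lebesgue_measure K.
have J0 : (0 < gammaJ p)%E.
  apply: lt_le_trans (stretched_exp_itv_gt0 p0 (lexx 0) ltr01) _.
  apply: ge0_subset_integral => //.
  - apply/measurable_EFinP/measurable_funTS; exact: measurable_stretched_exp.
  - by move=> v _; rewrite lee_fin expR_ge0.
  - by move=> v; rewrite /= !in_itv/= andbT => /andP[].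
have Joo := gammaJ_lty p0.
have Jfin : gammaJ p \is a fin_num by rewrite ge0_fin_numE// ltW.
pose J := fine (gammaJ p).
have Jgt0 : 0 < J by rewrite fine_gt0// J0.
pose W (v : K) : K := (\1_`[0, +oo[%classic v : K) * (stretched_exp p v / J).
have mS : measurable_fun setT (fun v => stretched_exp p v / J).
  by apply: measurable_funM => //; exact: measurable_stretched_exp.
have mW : measurable_fun setT W by apply: measurable_funM.
have W0 v : 0 <= W v.
  by rewrite mulr_ge0// divr_ge0 ?expR_ge0// ltW.
have intW (f : K -> K) : measurable_fun setT f -> (forall v, 0 <= f v) ->
    (\int[mdensity leb W0 mW]_v (f v)%:E =
     J^-1%:E * \int[leb]_(v in `[0%R, +oo[) (f v * stretched_exp p v)%:E)%E.
  move=> mf f0.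
  have mf' : measurable_fun setT (EFin \o f) by exact/measurable_EFinP.
  have f0' v : (0 <= (EFin \o f) v)%E by rewrite lee_fin.
  rewrite (integral_mdensity leb mW W0 mf' f0').
  rewrite -ge0_integralZl//; last 3 first.
  - apply/measurable_EFinP/measurable_funTS/measurable_funM => //.
    exact: measurable_stretched_exp.
  - by move=> v _; rewrite lee_fin mulr_ge0 ?expR_ge0.
  - by rewrite lee_fin invr_ge0 ltW.
  rewrite [RHS]integral_mkcond; apply: eq_integral => v _.
  rewrite patchE /W indicE; case: ifPn => _; rewrite ?mul1r ?mul0r ?mule0//.
  by rewrite -!EFinM; congr EFin; ring.
have m1 : mdensity leb W0 mW setT = 1%E.
  rewrite -[LHS]mul1e -integral_cst//= intW//.
  under eq_integral do rewrite mul1r.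
  by rewrite -/(gammaJ p) -(fineK Jfin) -/J -EFinM mulVf// gt_eqF.
have [P PE] := mass_one_probability m1.
exists _, _, P, (fun v => v `^ p); split.
- exact: measurable_powR.
- by move=> v; exact: powR_ge0.
- move=> t t0; rewrite PE intW//; last first.
    by apply: measurable_expRN; apply: measurable_funM.
  have t1 : 0 < 1 + t by rewrite ltr_pwDl.
  under eq_integral do rewrite -expRD -opprD -{2}[_ `^ p]mul1r -mulrDl [t + 1]addrC.
  rewrite stretched_exp_scale// invrK -(fineK Jfin) -/J -!EFinM.
  by congr EFin; field; rewrite gt_eqF.
move=> y z y0 yz.
set A := [set v | _].
have mA : measurable A.
  rewrite (_ : A = (@powR K)^~ p @^-1` `[y, z]%classic); last first.
    by apply/seteqP; split=> v; rewrite /A /= in_itv.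
  by rewrite -[_ @^-1` _]setTI; exact: (measurable_powR p).
rewrite -[A]setIT -integral_indic// PE intW//.
rewrite mule_gt0 ?lte_fin ?invr_gt0//.
have yz' : y `^ a < z `^ a.
  by apply: gt0_ltr_powR => //; rewrite ?nnegrE//; exact: le_trans (ltW yz).
apply: lt_le_trans (stretched_exp_itv_gt0 p0 (powR_ge0 y a) yz') _.
have -> : (\int[leb]_(v in `[(y `^ a)%R, (z `^ a)%R]) (stretched_exp p v)%:E =
    \int[leb]_(v in `[(y `^ a)%R, (z `^ a)%R]) ((\1_A v : K) * stretched_exp p v)%:E)%E.
  apply: eq_integral => v; rewrite inE/= in_itv/= => /andP[yv vz]; rewrite indicE mem_set ?mul1r//.
  have v0 : 0 <= v := le_trans (powR_ge0 y a) yv.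
  have vK w : 0 <= w -> (w `^ a) `^ p = w.
    by move=> w0; rewrite -powRrM mulfV ?gt_eqF// powRr1.
  have z0 : 0 <= z := le_trans y0 (ltW yz).
  rewrite /A/= -{1}(vK y y0) -(vK z z0).
  by rewrite !ge0_ler_powR ?nnegrE ?powR_ge0 ?(ltW p0).
apply: ge0_subset_integral => //.
- apply/measurable_EFinP/measurable_funTS/measurable_funM => //.
  exact: measurable_stretched_exp.
- by move=> v _; rewrite lee_fin mulr_ge0 ?expR_ge0.
- move=> v; rewrite /= !in_itv/= andbT => /andP[+ _].
  exact/le_trans/powR_ge0.
Qed.

(** The law has density [exp(- v^2) / sqrt pi], and [s], [z] are the parameters in which the square
    is already completed: with the density, the exponent becomes [- s (v + z)^2 + s z^2]. *)
Lemma normal_law (K : realType) :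
  exists d (T : measurableType d) (P : probability T K) (X : T -> K),
    measurable_fun setT X /\ forall s z, 0 < s ->
      (\int[P]_v (expR (- ((s - 1) * X v ^+ 2 + 2 * s * z * X v)))%:E)%E =
      (s `^ (- 2^-1) * expR (s * z ^+ 2))%:E.
Proof.
pose leb := @lebesgue_measure K.
pose sg (s : K) := Num.sqrt (2 * s)^-1.
have sg0 s : 0 < s -> sg s != 0.
  by move=> s0; rewrite gt_eqF// sqrtr_gt0 invr_gt0 mulr_gt0.
have pdfE (s z v : K) : 0 < s ->
    normal_pdf (- z) (sg s) v = Num.sqrt s / Num.sqrt pi * expR (- (s * (v + z) ^+ 2)).
  move=> s0; rewrite normal_pdfE ?sg0// /normal_peak /normal_fun.
  have -> : sg s ^+ 2 = (2 * s)^-1.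
    by rewrite sqr_sqrtr// invr_ge0 mulr_ge0// ltW.
  congr (_ * expR _).
    rewrite -mulrnAr -(mulr_natr pi) -sqrtrV ?mulr_ge0 ?pi_ge0 ?invr_ge0 ?ltW ?mulr_gt0//.
    rewrite -sqrtrV ?pi_ge0// -sqrtrM ?ltW//; congr Num.sqrt.
    have pi0 : pi != 0 :> K by rewrite gt_eqF ?pi_gt0.
    by move: (@pi K) pi0 => q q0; field; rewrite q0 gt_eqF.
  by rewrite opprK -mulr_natr; field; rewrite gt_eqF.
pose W := normal_pdf (0 : K) (sg 1).
have W0 v : 0 <= W v by exact: normal_pdf_ge0.
have mW : measurable_fun setT W by exact: measurable_normal_pdf.
have m1 : mdensity leb W0 mW setT = 1%E by exact: integral_normal_pdf.
have [P PE] := mass_one_probability m1.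
exists _, _, P, id; split=> // s z s0; rewrite PE.
set f := fun v : K => (expR (- ((s - 1) * v ^+ 2 + 2 * s * z * v)))%:E.
have mf : measurable_fun setT f.
  apply/measurable_EFinP/measurable_expRN/measurable_funD.
    by apply: measurable_funM => //; exact: exprn_measurable.
  exact: measurable_funM.
have f0 v : (0 <= f v)%E by rewrite lee_fin expR_ge0.
rewrite (integral_mdensity leb mW W0 mf f0).
transitivity (\int[leb]_v ((s `^ (- 2^-1) * expR (s * z ^+ 2))%:E *
    (normal_pdf (- z) (sg s) v)%:E))%E.
  apply: eq_integral => v _; rewrite -!EFinM; congr EFin.
  rewrite /W -oppr0 !pdfE// sqrtr1 addr0 mul1r.
  rewrite powRN powR12_sqrt ?(ltW s0)// mulrCA -expRD.
  have r0 : Num.sqrt s != 0 by rewrite gt_eqF ?sqrtr_gt0.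
  transitivity ((Num.sqrt s)^-1 * Num.sqrt s * ((Num.sqrt pi)^-1 *
      (expR (s * z ^+ 2) * expR (- (s * (v + z) ^+ 2))))); last by ring.
  by rewrite mulVf// !mul1r -expRD; congr (_ * expR _); ring.
rewrite ge0_integralZl//=; last 3 first.
- by apply/measurable_EFinP; exact: measurable_normal_pdf.
- by move=> v _; rewrite lee_fin normal_pdf_ge0.
- by rewrite lee_fin mulr_ge0 ?powR_ge0 ?expR_ge0.
by rewrite integral_normal_pdf mule1.
Qed.

(** * Entrywise measurability of random matrices *)

Section measurable_matrices.
Context (K : realType) d (T : measurableType d).
Implicit Types (m n p : nat).

Definition measurable_mx m n (A : T -> 'M[K]_(m, n)) :=
  forall i j, measurable_fun setT (fun x => A x i j).

Lemma measurable_mx_cst m n (A : 'M[K]_(m, n)) : measurable_mx (fun=> A).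
Proof. by move=> i j; exact: measurable_cst. Qed.

Lemma measurable_mx_tr m n (A : T -> 'M[K]_(m, n)) :
  measurable_mx A -> measurable_mx (fun x => (A x)^T).
Proof. by move=> mA i j; under eq_fun do rewrite mxE; exact: mA. Qed.

Lemma measurable_mx_mul m n p (A : T -> 'M[K]_(m, n)) (B : T -> 'M[K]_(n, p)) :
  measurable_mx A -> measurable_mx B -> measurable_mx (fun x => A x *m B x).
Proof.
move=> mA mB i j; under eq_fun do rewrite mxE.
by apply: measurable_sum => k; exact: measurable_funM.
Qed.

Lemma measurable_mx_add m n (A B : T -> 'M[K]_(m, n)) :
  measurable_mx A -> measurable_mx B -> measurable_mx (fun x => A x + B x).
Proof. by move=> mA mB i j; under eq_fun do rewrite mxE; exact: measurable_funD. Qed.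

Lemma measurable_mx_col m n p (A : T -> 'M[K]_(m, p)) (B : T -> 'M[K]_(n, p)) :
  measurable_mx A -> measurable_mx B -> measurable_mx (fun x => col_mx (A x) (B x)).
Proof.
move=> mA mB i j; under eq_fun do rewrite mxE.
by case: split_ordP => k _; [exact: mA|exact: mB].
Qed.

Lemma measurable_mx_row m n p (A : T -> 'M[K]_(p, m)) (B : T -> 'M[K]_(p, n)) :
  measurable_mx A -> measurable_mx B -> measurable_mx (fun x => row_mx (A x) (B x)).
Proof.
move=> mA mB i j; under eq_fun do rewrite mxE.
by case: split_ordP => k _; [exact: mA|exact: mB].
Qed.

Lemma measurable_mx_scalar n (X : T -> K) : measurable_fun setT X ->
  measurable_mx (fun x => (X x)%:M : 'M[K]_n).
Proof.
move=> mX i j; under eq_fun do rewrite mxE.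
by case: (i == j); [exact: mX|exact: measurable_cst].
Qed.

Lemma measurable_mxtrace n (A : T -> 'M[K]_n) :
  measurable_mx A -> measurable_fun setT (fun x => \tr (A x)).
Proof. by move=> mA; apply: measurable_sum => i; exact: mA. Qed.

End measurable_matrices.

Lemma measurable_mx_comp (K : realType) d (T : measurableType d)
    d' (T' : measurableType d') m n (A : T -> 'M[K]_(m, n)) (f : T' -> T) :
  measurable_fun setT f -> measurable_mx A -> measurable_mx (fun x => A (f x)).
Proof. by move=> mf mA i j; exact: measurableT_comp (mA i j) mf. Qed.

(** * Gaussian vectors and Wishart matrices *)

Section wishart.
Variable K : realType.

Definition dotv n (u v : 'cV[K]_n) : K := (u^T *m v) 0 0.

Lemma dotvC n (u v : 'cV[K]_n) : dotv u v = dotv v u.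
Proof. by rewrite /dotv !mxE; apply: eq_bigr => i _; rewrite !mxE mulrC. Qed.

Lemma dotvDl n (u v w : 'cV[K]_n) : dotv (u + v) w = dotv u w + dotv v w.
Proof. by rewrite /dotv linearD/= mulmxDl mxE. Qed.

Lemma dotvZl n a (u w : 'cV[K]_n) : dotv (a *: u) w = a * dotv u w.
Proof. by rewrite /dotv linearZ/= -scalemxAl mxE. Qed.

Lemma dotvDr n (u v w : 'cV[K]_n) : dotv w (u + v) = dotv w u + dotv w v.
Proof. by rewrite dotvC dotvDl !(dotvC w). Qed.

Lemma dotvZr n a (u w : 'cV[K]_n) : dotv w (a *: u) = a * dotv w u.
Proof. by rewrite dotvC dotvZl dotvC. Qed.

Lemma dotvN n (u w : 'cV[K]_n) : dotv w (- u) = - dotv w u.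
Proof. by rewrite -scaleN1r dotvZr mulN1r. Qed.

Lemma dotv_mul n (M : 'M[K]_n) u v : M^T = M -> dotv u (M *m v) = dotv (M *m u) v.
Proof. by move=> MT; rewrite /dotv trmx_mul MT mulmxA. Qed.

Lemma dotv_col m (a b : 'cV[K]_1) (u v : 'cV[K]_m) :
  dotv (col_mx a u) (col_mx b v) = a 0 0 * b 0 0 + dotv u v.
Proof.
by rewrite /dotv tr_col_mx mul_row_col [LHS]mxE; congr (_ + _); rewrite mxE big_ord1 mxE.
Qed.

Lemma qform_dotv n (M : 'M[K]_n) v : qform M v = dotv v (M *m v).
Proof. by rewrite /qform /dotv mulmxA. Qed.

(* The Schur complement data of 1 + M for M = [[c, w^T], [w, M']]. *)
Lemma psdmx_block m (M : 'M[K]_(1 + m)) : psdmx M ->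
  exists (c : K) (w y : 'cV[K]_m) (M' : 'M[K]_m),
  [/\ psdmx M', (1%:M + M') *m y = w, 0 <= c - dotv w y,
      \det (1%:M + M) = (1 + c - dotv w y) * \det (1%:M + M') &
      M = block_mx c%:M w^T w M'].
Proof.
move=> Mpsd; have [MT M0] := Mpsd.
pose M' := drsubmx M; pose c := ulsubmx M 0 0; pose w := dlsubmx M.
have ME : M = block_mx c%:M w^T w M'.
  by rewrite /c -mx11_scalar /w trmx_dlsub MT submxK.
have M'psd : psdmx M'.
  split; first by rewrite /M' trmx_drsub MT.
  move=> v; have := M0 (col_mx 0 v); rewrite {1}ME qform_block mxE.
  by rewrite expr0n !mul0r !add0r.
have N'u := pdmx_unit (pdmx1D M'psd).
exists c, w, (invmx (1%:M + M') *m w), M'; split=> //.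
- by rewrite mulKVmx.
- set y := _ *m w; have N'y : (1%:M + M') *m y = w by rewrite mulKVmx.
  have := M0 (col_mx 1%:M (- y)); rewrite {1}ME qform_block.
  have -> : qform M' (- y) = dotv w y - sqnorm y.
    have : qform (1%:M + M') y = dotv w y by rewrite qform_dotv N'y dotvC.
    rewrite qformD qform_scalar mul1r => <-; rewrite addrC addKr.
    by rewrite !qform_dotv mulmxN dotvN dotvC dotvN opprK dotvC.
  rewrite -[(w^T *m _) 0 0]/(dotv w (- y)) -[((- y)^T *m w) 0 0]/(dotv (- y) w).
  rewrite !mxE eqxx !mulr1n (dotvC (- y)) dotvN; have := sqnorm_ge0 y; lra.
- rewrite {1}ME [X in X + block_mx _ _ _ _]scalar_mx_block add_block_mx !add0r.
  rewrite det_schur// -mulmxA; congr ((_ - _) * _).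
  by rewrite !mxE eqxx !mulr1n.
Qed.

Lemma qform_colE m (c : K) (w : 'cV[K]_m) M' a u :
  qform (block_mx c%:M w^T w M' : 'M[K]_(1 + m)) (col_mx a%:M u) =
  a ^+ 2 * c + 2 * a * dotv w u + qform M' u.
Proof.
rewrite qform_block -[(w^T *m u) 0 0]/(dotv w u) -[(u^T *m w) 0 0]/(dotv u w).
by rewrite (dotvC u) !mxE eqxx !mulr1n; ring.
Qed.

Lemma fubini_probability d1 (T1 : measurableType d1) d2 (T2 : measurableType d2)
    (P1 : probability T1 K) (P2 : probability T2 K) (f : T1 * T2 -> K) :
  measurable_fun setT f -> (forall x, 0 <= f x) ->
  (\int[P1 \x P2]_x (f x)%:E = \int[P1]_x1 \int[P2]_x2 (f (x1, x2))%:E)%E.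
Proof.
move=> mf f0; rewrite fubini_tonelli1//; first exact/measurable_EFinP.
Qed.

Lemma ge0_integralMl d (T : measurableType d) (P : {measure set T -> \bar K})
    (k : K) (f : T -> K) : 0 <= k -> measurable_fun setT f -> (forall x, 0 <= f x) ->
  (\int[P]_x (k * f x)%:E = k%:E * \int[P]_x (f x)%:E)%E.
Proof.
move=> k0 mf f0; under eq_integral do rewrite EFinM.
rewrite (@ge0_integralZl _ _ _ P setT measurableT (EFin \o f)) //.
- exact/measurable_EFinP.
- by move=> x _; rewrite lee_fin.
Qed.

(* [u] is a centered Gaussian vector with independent coordinates of variance
   1/2. *)
Lemma gaussian_vector m :
  exists d (T : measurableType d) (P : probability T K) (u : T -> 'cV[K]_m),
    measurable_mx u /\ forall M z, psdmx M ->
      (\int[P]_x (expR (- (qform M (u x) +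
          2 * dotv (u x) ((1%:M + M) *m z))))%:E)%E =
      (\det (1%:M + M) `^ (- 2^-1) * expR (qform (1%:M + M) z))%:E.
Proof.
have [d1 [T1 [P1 [X [mX XE]]]]] := normal_law K.
elim: m => [|m [d2 [T2 [P2 [u [mu uE]]]]]].
  exists d1, T1, P1, (fun=> 0); split=> [[]//|M z Mpsd].
  have E (v w : 'cV[K]_0) : dotv v w = 0 by rewrite /dotv mxE big_ord0.
  have Eq (N : 'M[K]_0) v : qform N v = 0 by rewrite qform_dotv E.
  rewrite !Eq det_mx00 powR1 mul1r E mulr0 addr0 oppr0 expR0.
  by rewrite integral_cst// mul1e; exact: (probability_setT P1).
pose U (x : T1 * T2) : 'cV[K]_(1 + m) := col_mx (X x.1)%:M (u x.2).
have mU : measurable_mx U.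
  apply: measurable_mx_col.
    by apply: measurable_mx_scalar; exact: measurableT_comp.
  by apply: (measurable_mx_comp (f := snd)).
exists _, _, (P1 \x P2)%E, U; split=> //; rewrite -[m.+1]/(1 + m)%N => M z Mpsd.
rewrite fubini_probability; last 2 first.
- apply: measurable_expRN; apply: measurable_funD.
    apply: measurable_mx_mul => //.
    apply: measurable_mx_mul; [exact: measurable_mx_tr|exact: measurable_mx_cst].
  apply: measurable_funM => //; apply: measurable_mx_mul.
    exact: measurable_mx_tr.
  exact: measurable_mx_cst.
- by move=> x; exact: expR_ge0.
have [c [w [y [M' [M'psd N'y k0 detM ME]]]]] := psdmx_block Mpsd.
set N' := 1%:M + M' in N'y detM *.
set s := 1 + c - dotv w y in detM *.
have s0 : 0 < s by rewrite /s; lra.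
have N'T : N'^T = N' by case: (pdmx1D M'psd).
have NE : 1%:M + M = block_mx (1 + c)%:M w^T w N'.
  transitivity ((1%:M : 'M[K]_(1 + m)) + block_mx c%:M w^T w M').
    by rewrite [in LHS]ME.
  by rewrite scalar_mx_block add_block_mx !add0r -raddfD.
rewrite -(@vsubmxK _ 1 m 1 z); set z' := dsubmx _; rewrite [usubmx _]mx11_scalar.
set z1 := usubmx _ 0 0.
have Nz : (1%:M + M) *m col_mx z1%:M z' =
    col_mx ((1 + c) * z1 + dotv w z')%:M (z1 *: w + N' *m z').
  rewrite NE mul_block_col -scalar_mxM mul_mx_scalar; congr col_mx.
  by rewrite raddfD/= [w^T *m z']mx11_scalar.
rewrite Nz detM NE qform_colE.
(* Given the first coordinate, the linear term in the others is again of the form [N' z], with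
   [z = (X x1 + z1) y + z']. Integrating them out leaves the one-dimensional formula, with [s] the
   Schur complement in [1 + M]. *)
have N'z x1 : N' *m ((X x1 + z1) *: y + z') = (X x1 + z1) *: w + N' *m z'.
  by rewrite mulmxDr -scalemxAr N'y.
have mu' x1 : measurable_fun setT (fun x2 => expR (- (qform M' (u x2) +
    2 * dotv (u x2) (N' *m ((X x1 + z1) *: y + z'))))).
  apply: measurable_expRN; apply: measurable_funD.
    apply: measurable_mx_mul => //.
    apply: measurable_mx_mul; [exact: measurable_mx_tr|exact: measurable_mx_cst].
  apply: measurable_funM => //; apply: measurable_mx_mul.
    exact: measurable_mx_tr.
  exact: measurable_mx_cst.
have E1 x1 : (\int[P2]_x2 (expR (- (qform M (U (x1, x2)) + 2 * dotv (U (x1, x2))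
      (col_mx ((1 + c) * z1 + dotv w z')%:M (z1 *: w + N' *m z')))))%:E =
    (\det N' `^ (- 2^-1) * expR (s * z1 ^+ 2 * - 1 + (1 + c) * z1 ^+ 2 + 2 * z1 * dotv w z' + qform N' z') *
     expR (- ((s - 1) * X x1 ^+ 2 + 2 * s * z1 * X x1)))%:E)%E.
  transitivity (\int[P2]_x2 (expR (- (X x1 ^+ 2 * c +
      2 * X x1 * ((1 + c) * z1 + dotv w z'))) * expR (- (qform M' (u x2) +
      2 * dotv (u x2) (N' *m ((X x1 + z1) *: y + z')))))%:E)%E.
    apply: eq_integral => x2 _; congr EFin; rewrite -expRD; congr expR.
    rewrite N'z /U ME qform_colE dotv_col !dotvDr !dotvZr (dotvC _ w).
    by rewrite !mxE eqxx !mulr1n; ring.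
  rewrite ge0_integralMl ?expR_ge0//.
  rewrite uE// -/N' -EFinM; congr EFin.
  rewrite mulrCA -[RHS]mulrA -!expRD; congr (_ * expR _).
  rewrite qform_dotv N'z !dotvDr !dotvDl !dotvZl !dotvZr dotv_mul// N'y.
  rewrite qform_dotv (dotvC y) (dotvC z') /s; ring.
under eq_integral do rewrite E1.
rewrite ge0_integralMl ?mulr_ge0 ?powR_ge0 ?expR_ge0//; last first.
  apply: measurable_expRN; apply: measurable_funD.
    by apply: measurable_funM => //; exact: measurable_funX.
  exact: measurable_funM.
rewrite XE// -EFinM; congr EFin.
rewrite powRM ?(ltW s0)//; last exact/ltW/pdmx_det_gt0/pdmx1D.
rewrite mulrACA -expRD [s `^ _ * _]mulrC; congr (_ * expR _); ring.
Qed.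

(** Bartlett's decomposition, by induction on the size: the rank-one matrix of a vector made of the
    root of a gamma variable and a Gaussian vector, plus a Wishart matrix of size [m] and shape
    [a - 1/2]. Once [a = 0] is treated apart, both alternatives on [a] pass from [(m + 1, a)] to
    [(m, a - 1/2)]. *)
Lemma wishart m (a : K) : (exists k : nat, 2 * a = k%:R) \/ m%:R - 1 < 2 * a ->
  exists d (T : measurableType d) (P : probability T K) (S : T -> 'M[K]_m),
  [/\ measurable_mx S, (forall x v, 0 <= qform (S x) v) &
      forall M, psdmx M ->
        (\int[P]_x (expR (- \tr (S x *m M)))%:E)%E = (\det (1%:M + M) `^ (- a))%:E].
Proof.
have [d0 [T0 [P0 _]]] := normal_law K.
elim: m a => [|m IH] a ha.
  exists d0, T0, P0, (fun=> 0); split.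
  - by move=> [].
  - by move=> x v; rewrite /qform mxE big_ord0.
  move=> M _; rewrite det_mx00 powR1.
  under eq_integral do rewrite mul0mx mxtrace0 oppr0 expR0.
  by rewrite integral_cst// mul1e; exact: (probability_setT P0).
(* When [2 a] is an integer below the size, the descent by halves ends here, with the zero
   matrix. *)
have [a0|an0] := eqVneq a 0.
  exists d0, T0, P0, (fun=> 0); split.
  - by move=> i j; exact: measurable_cst.
  - by move=> x v; rewrite /qform mulmx0 mul0mx mxE.
  move=> M _; rewrite a0 oppr0 powRr0.
  under eq_integral do rewrite mul0mx mxtrace0 oppr0 expR0.
  by rewrite integral_cst// mul1e; exact: (probability_setT P0).
have a0 : 0 < a.
  case: ha => [[k ak]|ha]; last first.
    by rewrite -(pmulr_rgt0 a (ltr0n _ 2)) (le_lt_trans _ ha)// -natr1 addrK ler0n.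
  rewrite lt_def an0 -(pmulr_rge0 a (ltr0n _ 2)) ak; exact: ler0n.
have [|d3 [T3 [P3 [S [mS S0 SE]]]]] := IH (a - 2^-1).
  have -> : 2 * (a - 2^-1) = 2 * a - 1 by field.
  case: ha => [[[|k] ak]|ha]; [|left|right].
  - by move/eqP: ak; rewrite mulf_eq0 (negbTE an0) pnatr_eq0.
  - by exists k; rewrite ak -natr1 addrK.
  - by move: ha; rewrite -natr1; lra.
have [d1 [T1 [P1 [X [mX X0 XE _]]]]] := gamma_law a0.
have [d2 [T2 [P2 [u [mu uE]]]]] := gaussian_vector m.
pose b (x : T1 * (T2 * T3)) : 'cV[K]_(1 + m) :=
  col_mx (Num.sqrt (X x.1))%:M (u x.2.1).
pose Z (x : T1 * (T2 * T3)) : 'M[K]_(1 + m) :=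
  b x *m (b x)^T + block_mx 0 0 0 (S x.2.2).
have mb : measurable_mx b.
  apply: measurable_mx_col.
    apply: measurable_mx_scalar.
    have msqrt : measurable_fun setT (@Num.sqrt K).
      exact: continuous_measurable_fun (@sqrt_continuous K).
    exact: (measurableT_comp msqrt (measurableT_comp mX measurable_fst)).
  apply: (measurable_mx_comp (f := fun x => x.2.1)) => //.
  exact: measurableT_comp.
have mZ : measurable_mx Z.
  apply: measurable_mx_add.
    by apply: measurable_mx_mul => //; exact: measurable_mx_tr.
  apply: measurable_mx_col; apply: measurable_mx_row; try exact: measurable_mx_cst.
  apply: (measurable_mx_comp (f := fun x => x.2.2)) => //.
  exact: measurableT_comp.
exists _, _, (P1 \x (P2 \x P3))%E, Z; rewrite -[m.+1]/(1 + m)%N; split=> //.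
  move=> x v; rewrite qformD qform_gram addr_ge0 ?sqnorm_ge0//.
  rewrite -(vsubmxK v) qform_block mul0mx mulmx0 ![(0 : 'M[K]_1) _ _]mxE.
  by rewrite !mulr0 !add0r S0.
move=> M Mpsd.
have [c [w [y [M' [M'psd N'y k0 detM ME]]]]] := psdmx_block Mpsd.
set N' := 1%:M + M' in N'y detM *.
have dN' : 0 < \det N' by exact/pdmx_det_gt0/pdmx1D.
have mZM : measurable_fun setT (fun x => expR (- \tr (Z x *m M))).
  apply: measurable_expRN; apply: measurable_mxtrace; exact: measurable_mx_mul.
have ZM x : \tr (Z x *m M) = (c - dotv w y) * X x.1 + dotv w y * X x.1 +
    2 * Num.sqrt (X x.1) * dotv w (u x.2.1) + qform M' (u x.2.1) +
    \tr (S x.2.2 *m M').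
  rewrite mulmxDl mxtraceD; congr (_ + _).
    rewrite -mulmxA mxtrace_mulC /mxtrace big_ord1 -[(_ *m _) 0 0]/(qform M (b x)).
    by rewrite {1}ME qform_colE sqr_sqrtr//; ring.
  rewrite ME mulmx_block !mul0mx !add0r; rewrite mxtrace_block mxtrace0 add0r.
  by [].
rewrite fubini_probability//.
have msq M0 : measurable_fun setT (fun x => qform M0 (u x)).
  by apply: measurable_mx_mul => //; apply: measurable_mx_mul => //; exact: measurable_mx_tr.
have mdot v : measurable_fun setT (fun x => dotv (u x) v).
  by apply: measurable_mx_mul => //; exact: measurable_mx_tr.
have E1 x1 : (\int[(P2 \x P3)%E]_x2 (expR (- \tr (Z (x1, x2) *m M)))%:E =
    (\det N' `^ (- a) * expR (- ((c - dotv w y) * X x1)))%:E)%E.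
  rewrite fubini_probability//; last exact: measurableT_comp mZM (pair1_measurable x1).
  (* Since [N' y = w], the cross term is matched by the Gaussian formula at [z = r y]. The Gaussian
     factor completes the exponent of [\det N'] from [- (a - 1/2)] to [- a]. *)
  pose r := Num.sqrt (X x1); pose C := \det N' `^ (- (a - 2^-1)) * expR (- (c * X x1)).
  transitivity (\int[P2]_x2 (C * expR (- (qform M' (u x2) +
      2 * dotv (u x2) (N' *m (r *: y)))))%:E)%E.
    apply: eq_integral => x2 _.
    transitivity (\int[P3]_x3 (expR (- (c * X x1)) * expR (- (qform M' (u x2) +
      2 * dotv (u x2) (N' *m (r *: y)))) * expR (- \tr (S x3 *m M')))%:E)%E.
      apply: eq_integral => x3 _; congr EFin; rewrite -!expRD; congr expR.
      rewrite ZM /= -scalemxAr N'y dotvZr (dotvC (u x2)) -/r; ring.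
    rewrite ge0_integralMl ?mulr_ge0 ?expR_ge0//; last first.
      by apply: measurable_expRN; apply: measurable_mxtrace; exact: measurable_mx_mul.
    by rewrite SE// -EFinM /C -/N'; congr EFin; ring.
  rewrite ge0_integralMl ?mulr_ge0 ?powR_ge0 ?expR_ge0//; last first.
    by apply: measurable_expRN; apply: measurable_funD => //; exact: measurable_funM.
  rewrite uE// -/N' -EFinM /C mulrACA -powRD; last by rewrite (gt_eqF dN') implybT.
  rewrite -expRD.
  congr (_ `^ _ * expR _)%:E; first by ring.
  by rewrite qform_dotv -scalemxAr N'y dotvZl dotvZr (dotvC y) mulrA -expr2 sqr_sqrtr//; ring.
under eq_integral do rewrite E1.
rewrite ge0_integralMl ?powR_ge0//; last first.
  by apply: measurable_expRN; exact: measurable_funM.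
rewrite XE// -EFinM detM powRM ?(ltW dN')//; last by lra.
by rewrite mulrC addrA.
Qed.

End wishart.

(** * Gamma laws as mixtures over a Wishart matrix *)

Section gamma_mixture.
Variable K : realType.

Lemma powR_prod (I : finType) (f : I -> K) (a : K) : (forall i, 0 <= f i) ->
  \prod_i (f i `^ a) = (\prod_i f i) `^ a.
Proof.
move=> f0; suff [] : 0 <= \prod_i f i /\ \prod_i (f i `^ a) = (\prod_i f i) `^ a by [].
elim/big_rec2 : _ => [|i x y _ [y0 ->]]; first by rewrite powR1.
by rewrite mulr_ge0// powRM.
Qed.

(** [b j] is a diagonal entry of [A S A^T] with [S] Wishart. Given [S], the factor of [j] in the
    last formula is the Laplace transform of a noncentral gamma variable of scale [r 0 j], or of the
    constant [b j] if [r 0 j = 0]. Averaging such independent variables adds [diag_mx r] to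
    [A A^T]. *)
Lemma gamma_mixture n m (A : 'M[K]_(n, m)) (r : 'rV[K]_n) (a : K) :
  (forall j, 0 <= r 0 j) ->
  (exists k : nat, 2 * a = k%:R) \/ m%:R - 1 < 2 * a ->
  exists d (T : measurableType d) (P : probability T K) (b : 'I_n -> T -> K),
  [/\ forall j, measurable_fun setT (b j), forall j x, 0 <= b j x,
      forall s : 'rV[K]_n, (forall j, 0 <= s 0 j) ->
      (\int[P]_x (\prod_j expR (- (b j x * s 0 j)))%:E =
       (\det (1%:M + A *m A^T *m diag_mx s) `^ (- a))%:E)%E &
      forall t : 'rV[K]_n, (forall j, 0 <= t 0 j) ->
      (\int[P]_x (\prod_j ((1 + r 0 j * t 0 j) `^ (- a) *
          expR (- (b j x * (t 0 j / (1 + r 0 j * t 0 j))))))%:E)%E =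
      (\det (1%:M + (A *m A^T + diag_mx r) *m diag_mx t) `^ (- a))%:E].
Proof.
move=> r0 am; have [d [T [P [S [mS S0 SE]]]]] := wishart am.
pose b j x : K := (A *m S x *m A^T) j j.
have mb j : measurable_fun setT (b j).
  by apply: measurable_mx_mul => //; exact: measurable_mx_mul.
have b0 j x : 0 <= b j x.
  have := S0 x (A^T *m delta_mx j 0); rewrite -qform_conj trmxK /qform.
  by rewrite trmx_delta -rowE -colE mxE mxE.
have bE (s : 'rV[K]_n) : (forall j, 0 <= s 0 j) ->
    (\int[P]_x (\prod_j expR (- (b j x * s 0 j)))%:E =
     (\det (1%:M + A *m A^T *m diag_mx s) `^ (- a))%:E)%E.
  move=> s0; have Mpsd := psdmx_conj A (psdmx_diag s0).
  rewrite -mulmxA [X in X `^ _]det_mul_comm -SE//; apply: eq_integral => x _.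
  congr EFin; rewrite mulmxA mxtrace_mulC !mulmxA mul_mx_diag /mxtrace -sumrN.
  by rewrite expR_sum; apply: eq_bigr => j _; rewrite mxE.
exists _, _, P, b; split; [exact: mb|exact: b0|exact: bE|move=> t t0].
have rt0 j : 0 < 1 + r 0 j * t 0 j by rewrite ltr_pwDl// mulr_ge0.
pose s : 'rV[K]_n := \row_j (t 0 j / (1 + r 0 j * t 0 j)).
have s0 j : 0 <= s 0 j by rewrite mxE divr_ge0// ltW.
have prodE x : \prod_j ((1 + r 0 j * t 0 j) `^ (- a) *
    expR (- (b j x * (t 0 j / (1 + r 0 j * t 0 j))))) =
    (\prod_j (1 + r 0 j * t 0 j)) `^ (- a) * \prod_j expR (- (b j x * s 0 j)).
  rewrite big_split/=; congr (_ * _).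
    by rewrite powR_prod// => j; exact: ltW.
  by apply: eq_bigr => j _; rewrite mxE.
under eq_integral do rewrite prodE.
rewrite ge0_integralMl ?powR_ge0//; last 2 first.
- apply: measurable_prod => j _; apply: measurable_expRN.
  exact: measurable_funM.
- by move=> x; apply: prodr_ge0 => j _; exact: expR_ge0.
rewrite bE// -EFinM -powRM; last 2 first.
- by apply: prodr_ge0 => j _; exact: ltW.
- rewrite -mulmxA det_mul_comm; apply/ltW/pdmx_det_gt0/pdmx1D.
  exact/psdmx_conj/psdmx_diag.
congr (_ `^ _)%:E.
have -> : \prod_j (1 + r 0 j * t 0 j) = \det (1%:M + diag_mx r *m diag_mx t).
  have -> : 1%:M + diag_mx r *m diag_mx t = diag_mx (\row_j (1 + r 0 j * t 0 j)).
    by rewrite mulmx_diag -diag_const_mx -linearD/=; congr diag_mx; apply/rowP => j; rewrite !mxE.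
  by rewrite det_diag; apply: eq_bigr => j _; rewrite mxE.
(* Multiplication by [1 + diag r diag t] on the right turns [1 + A A^T diag s] into
   [1 + (A A^T + diag r) diag t]. *)
have st : diag_mx s *m (1%:M + diag_mx r *m diag_mx t) = diag_mx t.
  rewrite mulmx_diag -diag_const_mx -linearD/= mulmx_diag; congr diag_mx.
  by apply/rowP => j; rewrite !mxE divfK// gt_eqF.
rewrite mulrC -det_mulmx; congr (\det _).
rewrite [LHS]mulmxDl [X in X + _]mul1mx -[_ *m diag_mx s *m _]mulmxA st.
by rewrite [in RHS]mulmxDl addrAC addrA.
Qed.

Lemma nneseries_expR (x : K) : 0 <= x ->
  (\sum_(k <oo) (x ^+ k / k`!%:R)%:E = (expR x)%:E)%E.
Proof.
move=> x0; rewrite /expR; apply/cvg_lim => //.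
under eq_fun do rewrite sumEFin.
apply: cvg_EFin; first exact: nearW.
exact: is_cvg_series_exp_coeff.
Qed.


(** Given [x], the second coordinate is gamma of shape [a + k] with [k] Poisson of mean [b x]:
    summing [exp(- b) b^k / k! (1 + t)^(- a - k)] over [k] gives the stated factor. The test
    function [F] retains the joint law with [x]. [Num.max] enforces nonnegativity pointwise, as the
    laws [G k] live on all of [K]. *)
Lemma noncentral_gamma d (T : measurableType d) (P : probability T K)
    (b : T -> K) (a : K) : measurable_fun setT b -> (forall x, 0 <= b x) -> 0 < a ->
  exists (Q : probability (T * K)%type K), forall (F : T -> K) t,
    measurable_fun setT F -> (forall x, 0 <= F x) -> 0 <= t ->
    (\int[Q]_z (F z.1 * expR (- (t * Num.max z.2 0)))%:E =
     \int[P]_x (F x * ((1 + t) `^ (- a) * expR (- (b x * (t / (1 + t))))))%:E)%E.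
Proof.
move=> mb b0 a0.
have /choice[G GE] (k : nat) : exists G : probability K K, forall t, 0 <= t ->
    (\int[G]_y (expR (- (t * Num.max y 0)))%:E)%E = ((1 + t) `^ (- (a + k%:R)))%:E.
  have [|d1 [T1 [P1 [X [mX X0 XE _]]]]] := @gamma_law K (a + k%:R).
    by rewrite ltr_wpDr// ler0n.
  have [G GE] := pushforward_probability mX (probability_setT P1).
  exists G => t t0; rewrite GE; last 2 first.
  - apply/measurable_EFinP/measurable_expRN/measurable_funM => //.
    exact: measurable_maxr.
  - by move=> y; rewrite lee_fin expR_ge0.
  by rewrite -XE//; apply: eq_integral => y _; rewrite max_l.
pose W k (z : T * K) : K := expR (- b z.1) * (b z.1 ^+ k / k`!%:R).
have W0 k z : 0 <= W k z by rewrite mulr_ge0 ?expR_ge0// divr_ge0// exprn_ge0.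
have mb1 : measurable_fun setT (fun z : T * K => b z.1) by exact: measurableT_comp.
have mW k : measurable_fun setT (W k).
  apply: measurable_funM; first exact: measurable_expRN.
  by apply: measurable_funM => //; exact: measurable_funX.
pose nu k : {measure set (T * K) -> \bar K} := mdensity (P \x G k)%E (W0 k) (mW k).
pose Nu : {measure set (T * K) -> \bar K} := mseries nu 0.
have intE (F : T -> K) t : measurable_fun setT F -> (forall x, 0 <= F x) -> 0 <= t ->
    (\int[Nu]_z (F z.1 * expR (- (t * Num.max z.2 0)))%:E =
     \int[P]_x (F x * ((1 + t) `^ (- a) * expR (- (b x * (t / (1 + t))))))%:E)%E.
  move=> mF F0 t0; have t1 : 0 < 1 + t by rewrite ltr_pwDl.
  have mF1 : measurable_fun setT (fun z : T * K => F z.1) by exact: measurableT_comp.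
  have mE : measurable_fun setT (fun y : K => expR (- (t * Num.max y 0))).
    by apply: measurable_expRN; apply: measurable_funM => //; exact: measurable_maxr.
  have mFE : measurable_fun setT (fun z : T * K => F z.1 * expR (- (t * Num.max z.2 0))).
    by apply: measurable_funM => //; exact: (measurableT_comp mE measurable_snd).
  have FE0 z : (0 <= (F z.1 * expR (- (t * Num.max z.2 0)))%:E)%E.
    by rewrite lee_fin mulr_ge0// expR_ge0.
  rewrite ge0_integral_measure_series//; last exact/measurable_EFinP.
  pose h k x := F x * expR (- b x) * (b x ^+ k / k`!%:R) * ((1 + t) `^ (- (a + k%:R))).
  transitivity (\sum_(k <oo) \int[P]_x (h k x)%:E)%E.
    apply: eq_eseriesr => k _.
    rewrite (integral_mdensity _ (mW k) (W0 k)); last 2 first.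
    - exact/measurable_EFinP.
    - exact: FE0.
    under eq_integral do rewrite -EFinM.
    rewrite fubini_probability; last 2 first.
    - exact: measurable_funM.
    - by move=> z; rewrite mulr_ge0// -lee_fin.
    apply: eq_integral => x _ /=.
    transitivity (\int[G k]_y ((F x * expR (- b x) * (b x ^+ k / k`!%:R)) *
        expR (- (t * Num.max y 0)))%:E)%E.
      by apply: eq_integral => y _; congr EFin; rewrite /W/=; ring.
    rewrite ge0_integralMl//; first by rewrite GE// -EFinM.
    by rewrite !mulr_ge0 ?expR_ge0 ?exprn_ge0// invr_ge0.
  have mh k : measurable_fun setT (h k).
    apply: measurable_funM => //; apply: measurable_funM.
      by apply: measurable_funM => //; exact: measurable_expRN.
    by apply: measurable_funM => //; exact: measurable_funX.
  have h0 k x : 0 <= h k x.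
    by rewrite !mulr_ge0 ?expR_ge0 ?exprn_ge0 ?powR_ge0// invr_ge0.
  rewrite -integral_nneseries//; last 2 first.
  - by move=> k; exact/measurable_EFinP.
  - by move=> k x _; rewrite lee_fin.
  apply: eq_integral => x _.
  have bt0 : 0 <= b x / (1 + t) by rewrite divr_ge0// ltW.
  transitivity ((F x * expR (- b x) * (1 + t) `^ (- a))%:E *
      \sum_(k <oo) ((b x / (1 + t)) ^+ k / k`!%:R)%:E)%E.
    rewrite -nneseriesZl//; last first.
      by move=> k _; rewrite lee_fin divr_ge0// exprn_ge0.
    apply: eq_eseriesr => k _; rewrite -EFinM; congr EFin.
    rewrite /h opprD powRD; last by rewrite (gt_eqF t1) implybT.
    rewrite [_ `^ (- k%:R)]powRN powR_mulrn ?(ltW t1)// expr_div_n; ring.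
  rewrite nneseries_expR// -EFinM -!mulrA; congr (_ * _)%:E.
  rewrite mulrCA -expRD; congr (_ * expR _); field; exact: lt0r_neq0.
(* The total mass is the case [F = 1], [t = 0]. *)
have Nu1 : Nu setT = 1%E.
  have := intE (fun=> 1) 0 (measurable_cst _) (fun=> ler01) (lexx 0).
  under eq_integral do rewrite mul0r oppr0 expR0 mulr1.
  under [X in _ = X -> _]eq_integral do
    rewrite addr0 powR1 mul0r mulr0 oppr0 expR0 !mulr1.
  by rewrite !integral_cst// !mul1e => ->; exact: (probability_setT P).
have [Q QE] := mass_one_probability Nu1.
by exists Q => F t mF F0 t0; rewrite QE intE.
Qed.

End gamma_mixture.

(** * Existence of the multivariate gamma law *)

Section existence.
Variable K : realType.

Lemma measurable_tuple_box n (B : 'I_n -> set K) : (forall j, measurable (B j)) ->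
  measurable [set y : n.-tuple K | forall j, B j (tnth y j)].
Proof.
move=> mB; rewrite (_ : [set y | _] =
    \bigcap_(j in [set` 'I_n]) ((fun y : n.-tuple K => tnth y j) @^-1` B j)).
  apply: fin_bigcap_measurable => // j _.
  by rewrite -[_ @^-1` _]setTI; apply: measurable_tnth.
by apply/seteqP; split=> y /= H j; [move=> _; exact: H|exact: H].
Qed.

Lemma is_Gamma_pushforward n (a : K) (R : 'M[K]_n) d (T : measurableType d)
    (P : probability T K) (Y : 'I_n -> T -> K) :
  (forall j, measurable_fun setT (Y j)) -> (forall j x, 0 <= Y j x) ->
  (forall t : 'rV[K]_n, (forall j, 0 <= t 0 j) ->
    (\int[P]_x (expR (- \sum_j t 0 j * Y j x))%:E =
     (\det (1%:M + R *m diag_mx t) `^ (- a))%:E)%E) ->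
  exists mu : probability (n.-tuple K) K, is_Gamma a R mu.
Proof.
move=> mY Y0 LE; pose V x : n.-tuple K := [tuple Y j x | j < n].
have mV : measurable_fun setT V.
  apply/measurable_fun_tnthP => j.
  by rewrite (_ : _ \o _ = Y j)//; apply/funext => x /=; rewrite tnth_mktuple.
have [mu muE] := pushforward_probability mV (probability_setT P).
exists mu; split.
  set A := [set y | _].
  have mA : measurable A.
    apply: (@measurable_tuple_box n (fun=> [set y | 0 <= y])) => _.
    rewrite (_ : [set y | _] = `[0, +oo[%classic)//.
    by apply/seteqP; split=> y; rewrite /= in_itv/= andbT.
  rewrite -[A]setIT -integral_indic// muE; last 2 first.
  - exact/measurable_EFinP/measurable_indic.
  - by move=> x; rewrite lee_fin.
  transitivity (\int[P]_x (cst 1%E) x)%E.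
    apply: eq_integral => x _; rewrite indicE mem_set// /A /= => j.
    by rewrite tnth_mktuple.
  by rewrite integral_cst// mul1e; exact: (probability_setT P).
move=> t t0; rewrite unlock muE; last 2 first.
- apply/measurable_EFinP/measurable_expRN/measurable_sum => j.
  by apply: measurable_funM => //; exact: measurable_tnth.
- by move=> y; rewrite lee_fin expR_ge0.
rewrite -LE//; apply: eq_integral => x _; congr (expR (- _))%:E.
by apply: eq_bigr => j _; rewrite tnth_mktuple.
Qed.

(** [R = A A^T + diag (s, 0, ..., 0)] with [A] of [m] columns. Only coordinate 0 needs a noncentral
    gamma variable; the others are the [b j] themselves. The Wishart matrix has size [m], whence the
    bound [m - 1 < 2 a]. *)
Lemma Gamma_exists m (R : 'M[K]_(1 + m)) (a : K) : pdmx R -> 0 < a ->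
  (exists k : nat, 2 * a = k%:R) \/ m%:R - 1 < 2 * a ->
  exists mu : probability ((1 + m).-tuple K) K, is_Gamma a R mu.
Proof.
move=> Rpd a0 am.
have [B RB] := cholesky (pdmx_dr Rpd).
have [A [s [s0 _ RA]]] := cholesky_step Rpd RB.
pose r : 'rV[K]_(1 + m) := row_mx s%:M 0.
have r0 : r 0 0 = s.
  by rewrite /r mxE; case: split_ordP => k; [rewrite ord1 mxE eqxx mulr1n|case: k].
have rj j : j != 0 -> r 0 j = 0.
  rewrite /r mxE; case: split_ordP => k -> //; last by rewrite mxE.
  by rewrite ord1 => /negP[]; apply/eqP/val_inj.
have RE : R = A *m A^T + diag_mx r.
  rewrite {1}RA; congr (_ + _); apply/matrixP => i j.
  rewrite /r; rewrite diag_mx_row; congr (block_mx _ _ _ _ i j); last by rewrite linear0.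
  by apply/matrixP => k l; rewrite !ord1 !mxE.
have rge0 j : 0 <= r 0 j by have [->|/rj->] := eqVneq j 0; rewrite ?r0 // ltW.
have [d [T [P [b [mb b0 _ LE]]]]] := gamma_mixture A rge0 am.
(* The factor of coordinate 0 is a noncentral gamma transform with Poisson mean [b 0 x / s],
   evaluated at [t 0 0 * s]. *)
have mbs : measurable_fun setT (fun x => b 0 x / s).
  by apply: measurable_funM => //; exact: mb.
have bs0 x : 0 <= b 0 x / s by rewrite divr_ge0// ltW.
have [Q QE] := noncentral_gamma P mbs bs0 a0.
pose Y j (z : T * K) : K := if j == 0 :> 'I_(1 + m) then s * Num.max z.2 0 else b j z.1.
apply: (@is_Gamma_pushforward _ _ _ _ _ Q Y).
- move=> j; rewrite /Y; case: (j == 0); last exact: (measurableT_comp (mb j)).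
  apply: measurable_funM => //; apply: measurable_maxr => //.
- move=> j z; rewrite /Y; case: ifP => _ //.
  by rewrite mulr_ge0 ?(ltW s0)// le_max lexx orbT.
move=> t t0; rewrite RE -LE//.
pose F x := \prod_(j < 1 + m | j != 0) expR (- (t 0 j * b j x)).
transitivity (\int[Q]_z (F z.1 * expR (- ((t 0 0 * s) * Num.max z.2 0)))%:E)%E.
  apply: eq_integral => z _; congr EFin.
  rewrite -sumrN expR_sum (bigD1 0)//= mulrC; congr (_ * expR (- _)); last by rewrite /Y /= mulrA.
  by apply: eq_bigr => j j0; rewrite /Y (negbTE j0).
have F0 x : 0 <= F x by apply: prodr_ge0 => j _; exact: expR_ge0.
have mF : measurable_fun setT F.
  rewrite /F; under eq_fun do rewrite big_mkcond.
  apply: measurable_prod => j _; case: (j != 0); last exact: measurable_cst.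
  by apply: measurable_expRN; exact: measurable_funM.
rewrite QE ?mulr_ge0 ?(ltW s0)//.
apply: eq_integral => x _; congr EFin.
rewrite [RHS](bigD1 0)//= mulrC r0; congr (_ * _).
  rewrite [s * _]mulrC; congr (_ * expR (- _)).
  have ts : 0 < 1 + t 0 0 * s by rewrite ltr_pwDl// mulr_ge0 ?(ltW s0).
  by field; rewrite !gt_eqF.
apply: eq_bigr => j j0; rewrite rj// mul0r addr0 divr1 powR1 mul1r.
by rewrite mulrC.
Qed.

End existence.

(** * Laplace functionals tested on polynomials in exp (- s y) *)

Section polynomial_functionals.
Variable K : realType.

(* The value of the Laplace functional obtained by testing against
   [p (exp (- s y))], expressed through the Laplace transform [L]. *)
Definition lfun1 (s : K) (p : {poly K}) (L : K -> K) : K :=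
  \sum_(k < size p) p`_k * L (k%:R * s).

Definition lfun n (s : 'I_n -> K) (p : {poly K}) (L : 'rV[K]_n -> K) : K :=
  \sum_(k : {ffun 'I_n -> 'I_(size p)})
    (\prod_j p`_(k j)) * L (\row_j ((k j)%:R * s j)).

Lemma lfun_prod n (s : 'I_n -> K) p (f : 'I_n -> K -> K) :
  lfun s p (fun t => \prod_j f j (t 0 j)) = \prod_j lfun1 (s j) p (f j).
Proof.
rewrite /lfun1 bigA_distr_bigA; apply: eq_bigr => k _.
by rewrite -big_split/=; apply: eq_bigr => j _; rewrite mxE.
Qed.

Lemma lfun1_expR s p y :
  lfun1 s p (fun t => expR (- (t * y))) = p.[expR (- (s * y))].
Proof.
rewrite horner_coef; apply: eq_bigr => k _.
by rewrite -mulrA -mulrN expRM_natl.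
Qed.

Lemma lfun_sum n (s : 'I_n -> K) p (I : finType) (c : I -> K) L :
  lfun s p (fun t => \sum_i c i * L i t) = \sum_i c i * lfun s p (L i).
Proof.
rewrite /lfun; under eq_bigr do rewrite mulr_sumr.
rewrite exchange_big; apply: eq_bigr => i _; rewrite mulr_sumr.
by apply: eq_bigr => k _; ring.
Qed.

Lemma eq_lfun1 s p L M : 0 <= s ->
  (forall t, 0 <= t -> L t = M t) -> lfun1 s p L = lfun1 s p M.
Proof.
by move=> s0 LM; apply: eq_bigr => k _; rewrite LM// mulr_ge0// ler0n.
Qed.

Lemma lfun1Z s p c L : lfun1 s p (fun t => c * L t) = c * lfun1 s p L.
Proof. by rewrite mulr_sumr; apply: eq_bigr => k _; rewrite mulrCA. Qed.

Lemma lfun1_sum s p m (L : nat -> K -> K) :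
  lfun1 s p (fun t => \sum_(i < m) L i t) = \sum_(i < m) lfun1 s p (L i).
Proof.
rewrite /lfun1; under eq_bigr do rewrite mulr_sumr.
by rewrite exchange_big.
Qed.

(** The coefficients may have either sign, so linearity goes through the integrability of each
    [f i], which follows from its finite integral. *)
Lemma integral_lincomb (I : finType) (c L : I -> K) d (T : measurableType d)
    (P : {measure set T -> \bar K}) (D : set T) (f : I -> T -> K) :
  measurable D -> (forall i, measurable_fun setT (f i)) -> (forall i x, 0 <= f i x) ->
  (forall i, (\int[P]_(x in D) (f i x)%:E = (L i)%:E)%E) ->
  (\int[P]_(x in D) (\sum_i c i * f i x)%:E = (\sum_i c i * L i)%:E)%E.
Proof.
move=> mD mf f0 fL.
have fint i : P.-integrable D (EFin \o f i).
  apply/integrableP; split; first exact/measurable_EFinP/measurable_funTS/mf.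
  under eq_integral do rewrite gee0_abs ?lee_fin//.
  by rewrite fL// ltry.
under eq_integral do rewrite -sumEFin.
rewrite integral_sum//; last first.
  by move=> i; under eq_fun do rewrite EFinM; apply: integrableZl => //; exact: fint.
rewrite -sumEFin; apply: eq_bigr => i _.
under eq_integral do rewrite EFinM.
by rewrite integralZl ?fL//; exact: fint.
Qed.

Lemma ge0_integral_lower d (T : measurableType d) (P : {measure set T -> \bar K})
    (A : set T) (f : T -> K) (c : K) : measurable A -> measurable_fun setT f ->
  (forall x, 0 <= f x) -> (forall x, A x -> c <= f x) ->
  (c%:E * P A <= \int[P]_x (f x)%:E)%E.
Proof.
move=> mA mf f0 cf; have [c0|c0] := ltP c 0.
  apply: (@le_trans _ _ 0%E); first by rewrite mule_le0_ge0// lee_fin ltW.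
  by apply: integral_ge0 => x _; rewrite lee_fin.
rewrite -integral_cst//; apply: (@le_trans _ _ (\int[P]_(x in A) (f x)%:E)%E).
  by apply: ge0_le_integral => //; exact/measurable_EFinP/measurable_funTS.
apply: ge0_subset_integral => //; first exact/measurable_EFinP.
by move=> x _; rewrite lee_fin.
Qed.

(** For such [p] and [s >= 0], the function [p (exp(- s y))] is nonnegative and nonincreasing in
    [y >= 0]. *)
Definition window_poly (p : {poly K}) :=
  0 <= p.[0] /\ forall u v, 0 <= u -> u <= v -> v <= 1 -> p.[u] <= p.[v].

Lemma window_poly_ge0 p u : window_poly p -> 0 <= u <= 1 -> 0 <= p.[u].
Proof. by move=> [p0 pm] /andP[u0 u1]; apply: le_trans p0 (pm _ _ _ _ _). Qed.

Lemma measurable_horner (p : {poly K}) d (T : measurableType d) (f : T -> K) :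
  measurable_fun setT f -> measurable_fun setT (fun x => p.[f x]).
Proof.
move=> mf; under eq_fun do rewrite horner_coef.
by apply: measurable_sum => k; apply: measurable_funM => //; exact: measurable_funX.
Qed.

Lemma expRN01 (y : K) : 0 <= y -> 0 <= expR (- y) <= 1.
Proof. by move=> y0; rewrite expR_ge0 expR_le1 oppr_le0. Qed.

(** The functional is the expectation of [p (exp(- s e X))] with [X] gamma of shape [c], bounded
    below on the event [e X <= x] of probability [w]. Choosing [w] before [s] and [p] makes the
    bound survive the later limit. *)
Lemma lfun1_gamma_lower (e c x : K) : 0 < e -> 0 < c -> 0 < x ->
  exists2 w, 0 < w & forall s p, 0 <= s -> window_poly p ->
    w * p.[expR (- (s * x))] <= lfun1 s p (fun t => (1 + e * t) `^ (- c)).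
Proof.
move=> e0 c0 x0; have [d [T [P [X [mX X0 XE Xpos]]]]] := gamma_law c0.
set A := [set v | (0 <= X v <= x / e)%R].
have A0 : (0 < P A)%E by apply: Xpos => //; rewrite divr_gt0.
have mA : measurable A.
  rewrite (_ : A = X @^-1` `[0, x / e]%classic); last first.
    by apply/seteqP; split=> v; rewrite /A /= in_itv.
  by rewrite -[_ @^-1` _]setTI; exact: mX.
have Afin : P A \is a fin_num by exact: fin_num_measure.
exists (fine (P A)); first by rewrite fine_gt0// A0 -ge0_fin_numE.
move=> s p s0 pw.
rewrite -lee_fin EFinM muleC fineK//.
have <- : (\int[P]_v (p.[expR (- (s * (e * X v)))])%:E =
    (lfun1 s p (fun t => (1 + e * t) `^ (- c)))%:E)%E.
  rewrite /lfun1 -(@integral_lincomb _ _ _ _ _ P setT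
    (fun (k : 'I_(size p)) v => expR (- (k%:R * s * (e * X v)))))//.
  - by apply: eq_integral => v _; rewrite -lfun1_expR.
  - move=> k; apply: measurable_expRN; apply: measurable_funM => //.
    exact: measurable_funM.
  - move=> k; rewrite -XE ?mulr_ge0 ?ler0n ?(ltW e0)//.
    by apply: eq_integral => v _; congr (expR (- _))%:E; ring.
apply: ge0_integral_lower => //.
- apply: measurable_horner; apply: measurable_expRN.
  by apply: measurable_funM => //; exact: measurable_funM.
- by move=> v; rewrite window_poly_ge0// expRN01// !mulr_ge0 ?(ltW e0).
move=> v /andP[_ Xv]; have [_ pm] := pw; apply: pm; first exact: expR_ge0.
  by rewrite ler_expR lerN2 ler_wpM2l// mulrC -ler_pdivlMr.
by rewrite expR_le1 oppr_le0 !mulr_ge0 ?(ltW e0).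
Qed.

(** [e t (1 + e t)^(- c)] is the difference of the Laplace transforms of [e X] and [e (X + Y)], with
    [X] gamma of shape [c - 1] and [Y] exponential. The integrand is thus nonnegative, and the bound
    keeps an event on which [e X <= x] and [e Y >= 4 x]. *)
Lemma lfun1_gamma_deriv_lower (e c x : K) : 0 < e -> 1 < c -> 0 < x ->
  exists2 w, 0 < w & forall s p, 0 <= s -> window_poly p ->
    w * (p.[expR (- (s * x))] - p.[expR (- (s * (4 * x)))]) <=
    lfun1 s p (fun t => t * (1 + e * t) `^ (- c)).
Proof.
move=> e0 c1 x0; have c10 : 0 < c - 1 by rewrite subr_gt0.
have [d [T [P [X [mX X0 XE Xpos]]]]] := gamma_law c10.
have [d' [T' [P' [Y [mY Y0 YE Ypos]]]]] := gamma_law (@ltr01 K).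
set A := [set v | (0 <= X v <= x / e)%R].
set B := [set v | (4 * x / e <= Y v <= 4 * x / e + 1)%R].
have A0 : (0 < P A)%E by apply: Xpos => //; rewrite divr_gt0.
have B0 : (0 < P' B)%E.
  by apply: Ypos; rewrite ?ltrDl// divr_ge0 ?mulr_ge0 ?ltW.
have mA : measurable A.
  rewrite (_ : A = X @^-1` `[0, x / e]%classic); last first.
    by apply/seteqP; split=> v; rewrite /A /= in_itv.
  by rewrite -[_ @^-1` _]setTI; exact: mX.
have mB : measurable B.
  rewrite (_ : B = Y @^-1` `[4 * x / e, 4 * x / e + 1]%classic); last first.
    by apply/seteqP; split=> v; rewrite /B /= in_itv.
  by rewrite -[_ @^-1` _]setTI; exact: mY.
have Afin : P A \is a fin_num by exact: fin_num_measure.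
have Bfin : P' B \is a fin_num by exact: fin_num_measure.
have PA0 : 0 < fine (P A) by rewrite fine_gt0// A0 -ge0_fin_numE.
have PB0 : 0 < fine (P' B) by rewrite fine_gt0// B0 -ge0_fin_numE.
exists (e^-1 * (fine (P A) * fine (P' B))); first by rewrite !mulr_gt0// invr_gt0.
move=> s p s0 pw; rewrite -mulrA ler_pdivrMl//.
pose f (k : 'I_(size p)) (z : T * T') : K :=
  expR (- (k%:R * s * (e * X z.1))) * (1 - expR (- (k%:R * s * (e * Y z.2)))).
have ks k : 0 <= k%:R * s :> K by rewrite mulr_ge0// ler0n.
have kse k : 0 <= k%:R * s * e :> K by rewrite mulr_ge0// ltW.
have mX1 : measurable_fun setT (fun z : T * T' => X z.1) by exact: measurableT_comp.
have mY2 : measurable_fun setT (fun z : T * T' => Y z.2) by exact: measurableT_comp.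
have mf k : measurable_fun setT (f k).
  apply: measurable_funM.
    by apply: measurable_expRN; apply: measurable_funM => //; exact: measurable_funM.
  apply: measurable_funB => //.
  by apply: measurable_expRN; apply: measurable_funM => //; exact: measurable_funM.
have f0 k z : 0 <= f k z.
  rewrite mulr_ge0 ?expR_ge0// subr_ge0 expR_le1 oppr_le0.
  by rewrite !mulr_ge0 ?ler0n ?(ltW e0).
have fE k : (\int[(P \x P')%E]_z (f k z)%:E =
    (e * (k%:R * s * (1 + e * (k%:R * s)) `^ (- c)))%:E)%E.
  rewrite fubini_probability//.
  have t1 : 0 < 1 + k%:R * s * e by rewrite ltr_pwDl.
  have E1 : (\int[P']_y (1 - expR (- (k%:R * s * (e * Y y))))%:E =
      (1 - (1 + k%:R * s * e)^-1)%:E)%E.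
    transitivity (\int[P']_y (\sum_(b : bool) (if b then 1 else -1) *
        (if b then 1 else expR (- (k%:R * s * e * Y y))))%:E)%E.
      apply: eq_integral => y _; rewrite big_bool mulr1 mulN1r.
      by congr (1 - expR (- _))%:E; ring.
    rewrite (@integral_lincomb _ _
      (fun b : bool => if b then 1 else (1 + k%:R * s * e)^-1)).
    - by rewrite big_bool mulr1 mulN1r.
    - exact: measurableT.
    - case; first exact: measurable_cst.
      by apply: measurable_expRN; exact: measurable_funM.
    - by case=> y //; exact: expR_ge0.
    - case; first by rewrite integral_cst// mul1e; exact: (probability_setT P').
      by rewrite YE// powRN powRr1// ltW.
  transitivity (\int[P]_v ((1 - (1 + k%:R * s * e)^-1) *
      expR (- (k%:R * s * e * X v)))%:E)%E.
    apply: eq_integral => v _; rewrite /f /= ge0_integralMl ?expR_ge0//; last 2 first.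
    - apply: measurable_funB => //.
      by apply: measurable_expRN; apply: measurable_funM => //; exact: measurable_funM.
    - move=> y; rewrite subr_ge0 expR_le1 oppr_le0 !mulr_ge0 ?ler0n ?(ltW e0)//.
    by rewrite E1 -EFinM mulrC /= !mulrA.
  rewrite ge0_integralMl; last 3 first.
  - by rewrite subr_ge0 invf_le1// lerDl.
  - by apply: measurable_expRN; exact: measurable_funM.
  - by move=> v; exact: expR_ge0.
  rewrite XE// -EFinM opprB powRD; last by rewrite (gt_eqF t1) implybT.
  rewrite powRr1 ?(ltW t1)// [e * (_ * s)]mulrC; congr EFin.
  by field; exact: lt0r_neq0.
have -> : e * lfun1 s p (fun t => t * (1 + e * t) `^ (- c)) =
    \sum_(k < size p) p`_k * (e * (k%:R * s * (1 + e * (k%:R * s)) `^ (- c))).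
  by rewrite /lfun1 mulr_sumr; apply: eq_bigr => k _; ring.
rewrite -lee_fin -(@integral_lincomb _ _ _ _ _ (P \x P')%E setT f)//.
rewrite EFinM EFinM !fineK// muleC -(product_measure1E P P')//.
have fpE z : \sum_(i < size p) p`_i * f i z =
    p.[expR (- (s * (e * X z.1)))] - p.[expR (- (s * (e * (X z.1 + Y z.2))))].
  rewrite -!lfun1_expR /lfun1 -sumrB; apply: eq_bigr => k _.
  rewrite /f mulrBr mulr1 -expRD -mulrBr; congr (_ * (_ - expR _)); ring.
have pm := pw.2.
apply: ge0_integral_lower => //.
- exact: measurableX.
- by apply: measurable_sum => k; exact: measurable_funM.
- move=> z; rewrite fpE subr_ge0 pm ?expR_ge0//.
    by rewrite ler_expR lerN2 !ler_wpM2l ?lerDl ?(ltW e0).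
  by rewrite expR_le1 oppr_le0 !mulr_ge0 ?(ltW e0).
move=> z [/andP[_ Xz] /andP[Yz _]]; rewrite fpE lerB//.
  apply: pm; first exact: expR_ge0.
    by rewrite ler_expR lerN2 ler_wpM2l// mulrC -ler_pdivlMr.
  by rewrite expR_le1 oppr_le0 !mulr_ge0 ?(ltW e0).
apply: pm; first exact: expR_ge0.
  rewrite ler_expR lerN2 ler_wpM2l// [e * _]mulrC -ler_pdivrMr//.
  by apply: le_trans Yz _; rewrite lerDr.
by rewrite expR_le1 oppr_le0 !mulr_ge0 ?(ltW x0).
Qed.

End polynomial_functionals.

(** * Lower bounds for Laplace functionals of gamma type *)

Section domination.
Variable K : realType.
Implicit Types (p : {poly K}).

(** Both cases are read off the preceding lower bounds at [x = 1], whose left-hand sides are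
    nonnegative for a window polynomial. *)
Lemma lfun1_gamma_ge0 (e c s : K) p (i : bool) : 0 < e -> i%:R < c ->
  0 <= s -> window_poly p ->
  0 <= lfun1 s p (fun t => t ^+ i * (1 + e * t) `^ (- c)).
Proof.
move=> e0 ic s0 pw; have p01 y : 0 <= y -> 0 <= p.[expR (- y)].
  by move=> y0; rewrite window_poly_ge0// expRN01.
case: i ic => /= c0.
  have [w w0 /(_ s p s0 pw)] := lfun1_gamma_deriv_lower e0 c0 ltr01.
  apply: le_trans; apply: mulr_ge0; first exact: ltW.
  rewrite subr_ge0; apply: pw.2; first exact: expR_ge0.
    by rewrite ler_expR lerN2 ler_wpM2l// mulr1 ler1n.
  by rewrite expR_le1 oppr_le0 mulr1.
have [w w0 /(_ s p s0 pw)] := lfun1_gamma_lower e0 c0 ltr01.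
rewrite (@eq_lfun1 _ _ _ (fun t => t ^+ 0 * (1 + e * t) `^ (- c))
  (fun t => (1 + e * t) `^ (- c)))//; last by move=> t _; rewrite mul1r.
by apply: le_trans; apply: mulr_ge0; [exact: ltW|rewrite p01// mulr1].
Qed.

(* Expanding [exp ((b / e) / (1 + e t))] writes a noncentral gamma law as a
   Poisson mixture of gamma laws; only the leading term is kept. *)
Lemma lfun1_noncentral_lower (e c s b : K) p (i : bool) : 0 < e -> i%:R < c ->
  0 <= s -> 0 <= b -> window_poly p ->
  expR (- (b / e)) * lfun1 s p (fun t => t ^+ i * (1 + e * t) `^ (- c)) <=
  lfun1 s p (fun t => t ^+ i * ((1 + e * t) `^ (- c) *
    expR (- (b * (t / (1 + e * t)))))).
Proof.
move=> e0 ic s0 b0 pw; pose z := b / e.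
have z0 : 0 <= z by rewrite divr_ge0// ltW.
have e1 t : 0 <= t -> 0 < 1 + e * t.
  by move=> t0; rewrite ltr_pwDl// mulr_ge0// ltW.
pose S N t : K := series (exp_coeff (z / (1 + e * t))) N.
pose g t : K := t ^+ i * (1 + e * t) `^ (- c).
(* In the partial sums the term [k = 0] is [g]; the others are gamma terms of shape [c + k], on
   which the functional is nonnegative. *)
have gS N : lfun1 s p g <= lfun1 s p (fun t => g t * S N.+1 t).
  rewrite (@eq_lfun1 _ _ _ (fun t => g t * S N.+1 t) (fun t => \sum_(k < N.+1) z ^+ k / k`!%:R *
      (t ^+ i * (1 + e * t) `^ (- (c + k%:R)))))//; last first.
    move=> t t0; rewrite /S seriesEord mulr_sumr; apply: eq_bigr => k _.
    rewrite /exp_coeff/= /g opprD powRD; last by rewrite (gt_eqF (e1 _ t0)) implybT.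
    rewrite [_ `^ (- k%:R)]powRN powR_mulrn ?(ltW (e1 _ t0))// expr_div_n; ring.
  rewrite (@lfun1_sum _ s p N.+1 (fun k t => z ^+ k / k`!%:R *
      (t ^+ i * (1 + e * t) `^ (- (c + k%:R))))).
  rewrite big_ord_recl/= -[leLHS]addr0 lerD//.
    rewrite le_eqVlt; apply/orP; left; apply/eqP/eq_lfun1 => // t t0.
    by rewrite expr0 fact0 divr1 mul1r addr0.
  apply: sumr_ge0 => k _; rewrite lfun1Z mulr_ge0 ?divr_ge0 ?exprn_ge0//.
  by apply: lfun1_gamma_ge0 => //; rewrite ltr_wpDr// ler0n.
have cvgS : lfun1 s p (fun t => g t * S N t) @[N --> \oo] -->
    lfun1 s p (fun t => g t * expR (z / (1 + e * t))).
  rewrite /lfun1; apply: cvg_big => [|k _]; first exact: add_continuous.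
  apply: cvgMl_tmp; apply: cvgMl_tmp.
  exact: is_cvg_series_exp_coeff.
have H : lfun1 s p g <= lfun1 s p (fun t => g t * expR (z / (1 + e * t))).
  rewrite -(cvg_lim _ cvgS)//; apply: limr_ge.
    by apply/cvg_ex; eexists; exact: cvgS.
  by exists 1%N => // -[|N].
apply: le_trans (_ : expR (- z) * lfun1 s p (fun t => g t * expR (z / (1 + e * t))) <= _).
  by rewrite ler_wpM2l ?expR_ge0.
rewrite -lfun1Z le_eqVlt; apply/orP; left; apply/eqP/eq_lfun1 => // t t0.
rewrite /g mulrCA -!mulrA; congr (_ * (_ * _)); rewrite -expRD; congr expR.
by rewrite /z; field; rewrite !gt_eqF ?e1.
Qed.

(** With [R = e I + B B^T], the functional factorises given the Wishart matrix. Each factor is at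
    least [exp(- b j / e)] times the central one, and the mean of the product of these exponentials
    is [(\det R / e^n)^(- a)]. *)
Lemma lfun_det_lower n (R : 'M[K]_n) (e a : K) (s : 'I_n -> K) p (J : {set 'I_n}) :
  0 < e -> pdmx (R - e%:M) -> 1 < a ->
  (exists k : nat, 2 * a = k%:R) \/ n%:R - 1 < 2 * a ->
  (forall j, 0 <= s j) -> window_poly p ->
  (\det R / e ^+ n) `^ (- a) *
    \prod_j lfun1 (s j) p (fun t => t ^+ (j \in J) * (1 + e * t) `^ (- a)) <=
  lfun s p (fun t => (\prod_(j in J) t 0 j) *
    \det (1%:M + R *m diag_mx t) `^ (- a)).
Proof.
move=> e0 Rpd a1 an s0 pw.
have [B RB] := cholesky Rpd.
have RE : R = B *m B^T + diag_mx (const_mx e) by rewrite -RB diag_const_mx subrK.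
have [|d [T [P [b [mb b0 bE bL]]]]] := gamma_mixture B (r := const_mx e) (a := a) _ an.
  by move=> j; rewrite mxE ltW.
pose f (t : 'rV[K]_n) x := (\prod_(j in J) t 0 j) * \prod_j ((1 + e * t 0 j) `^ (- a) *
          expR (- (b j x * (t 0 j / (1 + e * t 0 j))))).
have t1 (t : 'rV[K]_n) j : (forall j, 0 <= t 0 j) -> 0 < 1 + e * t 0 j.
  by move=> t0; rewrite ltr_pwDl// mulr_ge0// ltW.
pose h j := lfun1 (s j) p (fun t => t ^+ (j \in J) * (1 + e * t) `^ (- a)).
have ja (i : bool) : i%:R < a by case: i => //; exact: lt_trans a1.
have h0 j : 0 <= h j by exact: lfun1_gamma_ge0.
pose tk (k : {ffun 'I_n -> 'I_(size p)}) : 'rV[K]_n := \row_j ((k j)%:R * s j).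
have tk0 k j : 0 <= tk k 0 j by rewrite mxE mulr_ge0// ler0n.
have mf t : measurable_fun setT (f t).
  apply: measurable_funM => //; apply: measurable_prod => j _.
  apply: measurable_funM => //; apply: measurable_expRN.
  exact: measurable_funM.
have f0 k x : 0 <= f (tk k) x.
  apply: mulr_ge0; apply: prodr_ge0 => j _ //.
  by rewrite mulr_ge0 ?powR_ge0 ?expR_ge0.
have fE k : (\int[P]_x (f (tk k) x)%:E = ((\prod_(j in J) tk k 0 j) *
    \det (1%:M + R *m diag_mx (tk k)) `^ (- a))%:E)%E.
  rewrite ge0_integralMl; last 3 first.
  - exact: prodr_ge0.
  - apply: measurable_prod => j _.
    by apply: measurable_funM => //; apply: measurable_expRN; exact: measurable_funM.
  - by move=> x; apply: prodr_ge0 => j _; rewrite mulr_ge0 ?powR_ge0 ?expR_ge0.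
  rewrite EFinM RE -bL//; congr (_ * _)%E; apply: eq_integral => x _.
  congr EFin; apply: eq_bigr => j _.
  by have -> : (const_mx e : 'rV[K]_n) 0 j = e by rewrite mxE.

rewrite -lee_fin /lfun -(@integral_lincomb _ _ _ _ _ _ P setT (fun k => f (tk k)))//.
have fx x : \sum_(k : {ffun 'I_n -> 'I_(size p)}) (\prod_j p`_(k j)) * f (tk k) x =
    \prod_j lfun1 (s j) p (fun t => t ^+ (j \in J) *
      ((1 + e * t) `^ (- a) * expR (- (b j x * (t / (1 + e * t)))))).
  rewrite -lfun_prod; apply: eq_bigr => k _; congr (_ * _).
  rewrite /f big_mkcond/= -big_split/=; apply: eq_bigr => j _.
  by case: (j \in J); rewrite ?expr1 ?expr0.
have low x : \prod_j h j * \prod_j expR (- (b j x * e^-1)) <=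
    \sum_(k : {ffun 'I_n -> 'I_(size p)}) (\prod_j p`_(k j)) * f (tk k) x.
  rewrite fx -big_split/=; apply: ler_prod => j _.
  rewrite mulr_ge0 ?expR_ge0//= mulrC.
  exact: lfun1_noncentral_lower.
have hp0 : 0 <= \prod_j h j by exact: prodr_ge0.
have E0 x : 0 <= \prod_j expR (- (b j x * e^-1)).
  by apply: prodr_ge0 => j _; exact: expR_ge0.
have mE : measurable_fun setT (fun x => \prod_j expR (- (b j x * e^-1))).
  apply: measurable_prod => j _; apply: measurable_expRN.
  exact: measurable_funM.
apply: (@le_trans _ _
    (\int[P]_x (\prod_j h j * \prod_j expR (- (b j x * e^-1)))%:E)%E); last first.
  apply: ge0_le_integral => //.
  - by move=> x _; rewrite lee_fin mulr_ge0.
  - exact/measurable_EFinP/measurable_funM.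
  - apply/measurable_EFinP/measurable_sum => k.
    exact: measurable_funM.
  - by move=> x _; rewrite lee_fin.
rewrite ge0_integralMl//.
have -> : (\int[P]_x (\prod_j expR (- (b j x * e^-1)))%:E =
    (\det (1%:M + B *m B^T *m diag_mx (const_mx e^-1)) `^ (- a))%:E)%E.
  rewrite -bE; last by move=> j; rewrite mxE invr_ge0 ltW.
  by apply: eq_integral => x _; congr EFin; apply: eq_bigr => j _; rewrite mxE.
rewrite -EFinM lee_fin mulrC; apply: ler_wpM2l => //.
rewrite le_eqVlt; apply/orP; left; apply/eqP; congr (_ `^ _).
rewrite diag_const_mx -RB mul_mx_scalar scalerBr scale_scalar_mx mulVf ?gt_eqF//.
by rewrite addrC subrK detZ mulrC exprVn.
Qed.

End domination.

(** * Increments of the Laplace functional along the segment *)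

Section increment.
Variable K : realType.

Lemma is_derive_bigsum (I : finType) (h : I -> K -> K) (dh : I -> K) (x : K) :
  (forall i, is_derive x 1 (h i) (dh i)) ->
  is_derive x 1 (fun y => \sum_i h i y) (\sum_i dh i).
Proof.
move=> hdh; rewrite -[fun y => _]/(fun y : K => \sum_i h i y).
have -> : (fun y => \sum_i h i y) = \sum_i h i by rewrite fct_sumE.
by elim/big_ind2 : _ => // [|] *; [exact: is_derive_cst|exact: is_deriveD].
Qed.

Lemma is_derive_horner (P : {poly K}) (x : K) : is_derive x 1 (horner P) P^`().[x].
Proof.
split; first exact: derivable_horner.
by rewrite -derive1E -derivE.
Qed.

Lemma det_one_add_mul_diag_gt0 n (R : 'M[K]_n) (t : 'rV[K]_n) :
  pdmx R -> (forall j, 0 <= t 0 j) -> 0 < \det (1%:M + R *m diag_mx t).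
Proof.
move=> Rpd t0; have [U ->] := cholesky Rpd.
rewrite -mulmxA det_mul_comm; apply/pdmx_det_gt0/pdmx1D.
exact/psdmx_conj/psdmx_diag.
Qed.

Variables (n : nat) (A B : 'M[K]_n).
Hypotheses (Apd : pdmx A) (Aoff : offdiag_le0 (invmx A)) (BT : B^T = B)
  (Bd : forall i, B i i = 0) (B0 : forall i j, 0 <= B i j)
  (ABpd : forall x, 0 <= x <= 1 -> pdmx (A + x *: B)).

Let minorp (J : {set 'I_n}) : {poly K} := \det (selmx J (linpmx A B)).

Let detp (t : 'rV[K]_n) : {poly K} :=
  \sum_(J : {set 'I_n}) (\prod_(j in J) t 0 j) *: minorp J.

Let horner_detp t x : (detp t).[x] = \det (1%:M + (A + x *: B) *m diag_mx t).
Proof.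
rewrite det_one_add_mul_diag horner_sum; apply: eq_bigr => J _.
by rewrite hornerZ /minorp selmx_linp horner_det_linpmx selmxD.
Qed.

Let minorp_le0 J x : 0 <= x <= 1 -> (minorp J)^`().[x] <= 0.
Proof.
by move=> /[dup] x01 /andP[x0 _]; apply: deriv_minor_le0 => //; exact: ABpd.
Qed.

(** The determinant is the minor of the full index set, whose derivative is nonpositive. *)
Lemma det_segment_le x : 0 <= x <= 1 -> \det (A + x *: B) <= \det A.
Proof.
move=> /andP[x0 x1].
pose f := horner (minorp [set: 'I_n]%SET).
have fE y : f y = \det (A + y *: B).
  by rewrite /f /minorp selmx_linp horner_det_linpmx -selmxD selmxT.
rewrite -fE -[in leRHS](addr0 A) -(scale0r B) -fE.
apply: (@ler0_derive1_nincr _ f 0 1) => //.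
- move=> y; rewrite in_itv/= => /andP[y0 y1].
  by rewrite -derivE minorp_le0// !ltW.
- by apply: derivable_within_continuous => y _; exact: derivable_horner.
Qed.

Variables (al : K) (al0 : 0 < al) (s : 'I_n -> K) (s0 : forall j, 0 <= s j)
  (p : {poly K}).

Let Phi x := lfun s p (fun t => \det (1%:M + (A + x *: B) *m diag_mx t) `^ (- al)).

(** Mean value theorem for the finite sum [Phi]: differentiating the power raises the shape to
    [al + 1] and brings out the derivatives of the minors. *)
Lemma lfun_det_increment x1 x2 : 0 <= x1 -> x1 < x2 -> x2 <= 1 ->
  exists2 x, 0 <= x <= 1 &
    Phi x2 - Phi x1 = al * (x2 - x1) * \sum_(J : {set 'I_n}) - (minorp J)^`().[x] *
      lfun s p (fun t => (\prod_(j in J) t 0 j) *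
        \det (1%:M + (A + x *: B) *m diag_mx t) `^ (- (al + 1))).
Proof.
move=> x10 x12 x21.
pose tk (k : {ffun 'I_n -> 'I_(size p)}) : 'rV[K]_n := \row_j ((k j)%:R * s j).
have tk0 k j : 0 <= tk k 0 j by rewrite mxE mulr_ge0// ler0n.
pose c (k : {ffun 'I_n -> 'I_(size p)}) := \prod_j p`_(k j).
pose dPhi x := \sum_k c k * (- al * (detp (tk k)).[x] `^ (- al - 1) * (detp (tk k))^`().[x]).
have PhiE : Phi = (fun x => \sum_k c k * (detp (tk k)).[x] `^ (- al)).
  by apply/funext => x; apply: eq_bigr => k _; rewrite horner_detp.
have detp0 k x : 0 <= x <= 1 -> 0 < (detp (tk k)).[x].
  by move=> x01; rewrite horner_detp det_one_add_mul_diag_gt0//; exact: ABpd.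
have dP (x : K) : 0 <= x <= 1 -> is_derive x 1 Phi (dPhi x).
  move=> x01; rewrite PhiE; apply: is_derive_bigsum => k.
  apply: is_deriveZ.
  have H1 := @is_derive1_powR K (- al) _ (detp0 k x x01).
  have H2 := is_derive_horner (detp (tk k)) x.
  exact: (@is_derive1_comp _ (fun y : K => y `^ (- al)) (horner (detp (tk k))) x _ _ H1 H2).
have x01 x : x \in `[x1, x2] -> 0 <= x <= 1.
  rewrite in_itv/= => /andP[xx1 xx2].
  by rewrite (le_trans x10)//= (le_trans xx2).
have [x xx ->] : exists2 x, x \in `]x1, x2[ & Phi x2 - Phi x1 = dPhi x * (x2 - x1).
  apply: MVT => //.
    by move=> x xx; apply/dP/x01; exact: subset_itv_oo_cc xx.
  apply: derivable_within_continuous => x xx.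
  by have [] := dP x (x01 x xx).
have {}x01 : 0 <= x <= 1 by apply/x01; exact: subset_itv_oo_cc xx.
exists x => //; rewrite mulrAC; congr (_ * _).
rewrite -(@lfun_sum _ n s p _ (fun J => - (minorp J)^`().[x]) (fun J t =>
  (\prod_(j in J) t 0 j) * \det (1%:M + (A + x *: B) *m diag_mx t) `^ (- (al + 1)))).
rewrite mulr_sumr; apply: eq_bigr => k _.
rewrite -/(c k) -/(tk k) -horner_detp opprD.
have -> : (detp (tk k))^`().[x] =
    \sum_(J : {set 'I_n}) (\prod_(j in J) tk k 0 j) * (minorp J)^`().[x].
  rewrite raddf_sum horner_sum; apply: eq_bigr => J _ /=.
  by rewrite derivZ hornerZ.
set E := _ `^ _; set S := \sum_(J : {set 'I_n}) _.
have -> : \sum_(J : {set 'I_n}) - (minorp J)^`().[x] *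
    ((\prod_(j in J) tk k 0 j) * E) = - (S * E).
  by rewrite /S mulr_suml -sumrN; apply: eq_bigr => J _; ring.
by ring.
Qed.

(** All terms of the sum over [J] are nonnegative, and only [J = {i, j}] is kept. The intermediate
    point [x] is eliminated by [A i j + x * B i j >= A i j] and [\det (A + x B) <= \det A]. *)
Lemma lfun_det_increment_lower (e : K) i j x1 x2 :
  0 < e -> (forall x, 0 <= x <= 1 -> pdmx (A + x *: B - e%:M)) ->
  (exists k : nat, 2 * (al + 1) = k%:R) \/ n%:R - 1 < 2 * (al + 1) ->
  window_poly p -> i != j -> A i i = 1 -> A j j = 1 ->
  (forall i j, 0 <= A i j) ->
  0 <= x1 -> x1 < x2 -> x2 <= 1 ->
  al * (x2 - x1) * (2 * A i j * B i j * (\det A / e ^+ n) `^ (- (al + 1)) *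
    \prod_k lfun1 (s k) p
      (fun t => t ^+ (k \in [set i; j]%SET) * (1 + e * t) `^ (- (al + 1)))) <=
  Phi x2 - Phi x1.
Proof.
move=> e0 epd an pw ij Ai Aj A0 x10 x12 x21.
have [x x01 ->] := lfun_det_increment x10 x12 x21.
have al1 : 1 < al + 1 by rewrite ltrDr.
have low (J : {set 'I_n}) : (\det (A + x *: B) / e ^+ n) `^ (- (al + 1)) *
    \prod_k lfun1 (s k) p (fun t => t ^+ (k \in J) * (1 + e * t) `^ (- (al + 1))) <=
  lfun s p (fun t => (\prod_(k in J) t 0 k) *
        \det (1%:M + (A + x *: B) *m diag_mx t) `^ (- (al + 1))).
  exact: lfun_det_lower e0 (epd x x01) al1 an s0 pw.
have h0 (J : {set 'I_n}) : 0 <= \prod_k lfun1 (s k) p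
    (fun t => t ^+ (k \in J) * (1 + e * t) `^ (- (al + 1))).
  apply: prodr_ge0 => k _; apply: lfun1_gamma_ge0 => //.
  by case: (k \in J) => //; exact: lt_trans al1.
have dx0 : 0 < \det (A + x *: B) / e ^+ n.
  by rewrite divr_gt0 ?exprn_gt0//; apply/pdmx_det_gt0/ABpd.
apply: ler_wpM2l; first by rewrite mulr_ge0 ?subr_ge0 ?ltW.
rewrite (bigD1 [set i; j]%SET)//= -[leLHS]addr0 lerD//; last first.
  apply: sumr_ge0 => J _; rewrite mulr_ge0 ?oppr_ge0 ?minorp_le0//.
  by apply: le_trans (low J); rewrite mulr_ge0// powR_ge0.
have AT : A^T = A by case: Apd.
have [x0 _] := andP x01.
rewrite /minorp deriv_minor2// opprK -[leLHS]mulrA.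
apply: ler_pM.
- by rewrite !mulr_ge0.
- by rewrite mulr_ge0// powR_ge0.
- rewrite ler_wpM2r// ler_wpM2l// lerDl mulr_ge0//.
apply: le_trans (low _); rewrite ler_wpM2r//.
rewrite !powRN lef_pV2 ?posrE ?powR_gt0//; last first.
  by rewrite divr_gt0 ?exprn_gt0//; exact: pdmx_det_gt0.
apply: ge0_ler_powR; rewrite ?nnegrE ?(ltW dx0)//.
- exact/ltW/(lt_trans ltr01).
- by rewrite divr_ge0 ?exprn_ge0 ?(ltW e0)//; exact/ltW/pdmx_det_gt0.
by rewrite ler_pM2r ?invr_gt0 ?exprn_gt0// det_segment_le.
Qed.

End increment.

(** * Strict monotonicity of the distribution function *)

Section cdf_bounds.
Variable K : realType.

Definition orthant n : set (n.-tuple K) := [set y | forall j, 0 <= tnth y j].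

Arguments orthant {n}.

Definition lower_box n (x : 'I_n -> K) : set (n.-tuple K) :=
  [set y | forall j, tnth y j <= x j].

Lemma measurable_orthant n : measurable (@orthant n).
Proof.
apply: (@measurable_tuple_box K n (fun=> [set y | 0 <= y])) => _.
rewrite (_ : [set y | _] = `[0, +oo[%classic)//.
by apply/seteqP; split=> y; rewrite /= in_itv/= andbT.
Qed.

Lemma measurable_lower_box n (x : 'I_n -> K) : measurable (lower_box x).
Proof.
apply: (@measurable_tuple_box K n (fun j => [set y | y <= x j])) => j.
by rewrite (_ : [set y | _] = `]-oo, x j]%classic).
Qed.

Variables (n : nat) (a : K) (R : 'M[K]_n) (mu : probability (n.-tuple K) K).
Hypothesis muG : is_Gamma a R mu.
Variables (s : 'I_n -> K) (p : {poly K}).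
Hypotheses (s0 : forall j, 0 <= s j) (pw : window_poly p).

Local Notation L := (fun t => \det (1%:M + R *m diag_mx t) `^ (- a)).
Local Notation phi j y := p.[expR (- (s j * y))].

(** The integral is restricted to the orthant, which has full mass, because there the arguments
    [exp(- s y)] lie in [0, 1], where [p] is controlled. *)
Lemma integral_window :
  (\int[mu]_(y in @orthant n) (\prod_j phi j (tnth y j))%:E = (lfun s p L)%:E)%E.
Proof.
have [muD LE] := muG; have mD := @measurable_orthant n.
have muDc : mu (~` @orthant n) = 0%E.
  by rewrite probability_setC// muD subee.
have me (t : 'rV[K]_n) : measurable_fun setT
    (fun y : n.-tuple K => expR (- \sum_j t 0 j * tnth y j)).
  apply: measurable_expRN; apply: measurable_sum => j.
  by apply: measurable_funM => //; exact: measurable_tnth.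
pose tk (k : {ffun 'I_n -> 'I_(size p)}) : 'rV[K]_n := \row_j ((k j)%:R * s j).
have tk0 k j : 0 <= tk k 0 j by rewrite mxE mulr_ge0// ler0n.
rewrite /lfun -(@integral_lincomb _ _ _ _ _ _ mu (@orthant n)
  (fun k y => expR (- \sum_j tk k 0 j * tnth y j)))//.
- apply: eq_integral => y _; congr EFin.
  under eq_bigr do rewrite -lfun1_expR.
  rewrite /lfun1 bigA_distr_bigA; apply: eq_bigr => k _.
  rewrite big_split/=; congr (_ * _); rewrite -sumrN expR_sum.
  by apply: eq_bigr => j _; rewrite mxE.
move=> k; have := LE (tk k) (tk0 k); rewrite unlock => <-.
rewrite (@ge0_negligible_integral _ _ _ mu setT (~` @orthant n))//.
- by rewrite setTD setCK.
- exact: measurableC.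
- exact/measurable_EFinP.
Qed.

Let phi01 j y : 0 <= y -> 0 <= phi j y.
Proof. by move=> y0; rewrite window_poly_ge0// expRN01// mulr_ge0. Qed.

Let phi_le j y z : 0 <= y -> y <= z -> phi j z <= phi j y.
Proof.
move=> y0 yz; apply: pw.2; first exact: expR_ge0.
  by rewrite ler_expR lerN2 ler_wpM2l.
by rewrite expR_le1 oppr_le0 mulr_ge0.
Qed.

Let mprod : measurable_fun setT (fun y : n.-tuple K => \prod_j phi j (tnth y j)).
Proof.
apply: measurable_prod => j _; apply: measurable_horner; apply: measurable_expRN.
by apply: measurable_funM => //; exact: measurable_tnth.
Qed.

Let mu_orthantI (A : set (n.-tuple K)) : measurable A -> mu (orthant `&` A) = mu A.
Proof.
move=> mA; have mD := @measurable_orthant n; have [muD _] := muG.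
apply/eqP; rewrite eq_le; apply/andP; split.
  by apply: le_measure; rewrite ?inE//; exact: measurableI.
have mDA : measurable (orthant `&` A) by exact: measurableI.
have mDc : measurable (~` @orthant n) by exact: measurableC.
apply: (@le_trans _ _ (mu (orthant `&` A `|` ~` orthant))).
  apply: le_measure; rewrite ?inE//; first exact: measurableU.
  by move=> y Ay; have [Dy|Dy] := pselect (orthant y); [left|right].
have muDc : mu (~` @orthant n) = 0%E.
  by rewrite probability_setC// muD subee.
apply: (@le_trans _ _ (mu (orthant `&` A) + mu (~` orthant))%E).
  exact: measureU2.
by rewrite muDc adde0.
Qed.

(** On the part of the box in the orthant, each factor is at least its value at the corner [x]. *)
Lemma cdf_window_le (x : 'I_n -> K) : (forall j, 0 <= x j) ->
  \prod_j phi j (x j) * fine (mu (lower_box x)) <= lfun s p L.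
Proof.
move=> x0; have mB := measurable_lower_box x; have mD := @measurable_orthant n.
rewrite -lee_fin EFinM fineK ?fin_num_measure// -integral_window.
rewrite -(mu_orthantI mB) -integral_cst//; last exact: measurableI.
apply: (@le_trans _ _ (\int[mu]_(y in orthant `&` lower_box x)
  (\prod_j phi j (tnth y j))%:E)%E).
  apply: ge0_le_integral => //.
  - exact: measurableI.
  - by move=> y _; rewrite lee_fin prodr_ge0// => j _; exact: phi01.
  - exact/measurable_EFinP/measurable_funTS.
  - move=> y [y0 yx]; rewrite lee_fin; apply: ler_prod => j _.
    by rewrite phi01//= phi_le// ?y0 ?yx.
apply: ge0_subset_integral => //.
- exact: measurableI.
- exact/measurable_EFinP/measurable_funTS.
- by move=> y y0; rewrite lee_fin prodr_ge0// => j _; exact/phi01/y0.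
Qed.

(** Outside the box some coordinate exceeds [x j]; then the product is at most [phi j (x j)], the
    other factors being at most 1. *)
Lemma window_le_cdf (x : 'I_n -> K) : (forall j, 0 <= x j) -> p.[1] <= 1 ->
  lfun s p L <= fine (mu (lower_box x)) + \sum_j phi j (x j).
Proof.
move=> x0 p1; have mB := measurable_lower_box x; have mD := @measurable_orthant n.
have phi1 j y : 0 <= y -> phi j y <= 1.
  move=> y0; apply: le_trans p1; apply: pw.2; rewrite ?expR_ge0//.
  by rewrite expR_le1 oppr_le0 mulr_ge0.
have S0 : 0 <= \sum_j phi j (x j) by apply: sumr_ge0 => j _; exact: phi01.
rewrite -lee_fin EFinD fineK ?fin_num_measure// -integral_window.
apply: (@le_trans _ _ (\int[mu]_(y in @orthant n)
    ((\1_(lower_box x) y + \sum_j phi j (x j))%:E))%E).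
  apply: ge0_le_integral => //.
  - by move=> y y0; rewrite lee_fin prodr_ge0// => j _; exact/phi01/y0.
  - exact/measurable_EFinP/measurable_funTS.
  - by apply/measurable_EFinP/measurable_funTS/measurable_funD.
  move=> y y0; rewrite lee_fin indicE; have [yx|] := boolP (y \in lower_box x).
    rewrite -[leLHS]addr0 lerD//; apply: prodr_ile1 => j _.
    by rewrite phi01 ?phi1 ?y0.
  move=> yx; have [j xj] : exists j, x j < tnth y j.
    move: yx; rewrite notin_setE => /existsNP[j /negP]; rewrite -ltNge.
    by exists j.
  rewrite add0r (bigD1 j)//= [leRHS](bigD1 j)//= -[leLHS]addr0.
  apply: lerD; last by apply: sumr_ge0 => i _; exact: phi01.
  apply: le_trans (phi_le j (x0 j) (ltW xj)).
  rewrite ler_piMr ?phi01 ?y0//; apply: prodr_ile1 => i _.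
  by rewrite phi01 ?phi1 ?y0.
under eq_integral do rewrite EFinD.
rewrite ge0_integralD//; last first.
  exact/measurable_EFinP/measurable_funTS.
apply: leeD.
  rewrite integral_indic// setIC.
  by apply: le_measure; rewrite ?inE//; exact: measurableI.
rewrite integral_cst//; have [muD _] := muG.
by rewrite [X in (_ * X <= _)%E](_ : _ = 1%E) ?mule1.
Qed.

End cdf_bounds.

(** * Polynomials approximating a step *)

Section step_polynomials.
Variable K : realType.

(** On [0, 1] the value is near 0 when [N u] is small and near 1 when [N u] is large: a step at
    scale [1 / N]. *)
Definition step_poly N : {poly K} := 1 - (1 - 'X) ^+ N.

Lemma step_polyE N u : (step_poly N).[u] = 1 - (1 - u) ^+ N.
Proof. by rewrite /step_poly !hornerE. Qed.

Lemma window_step_poly N : window_poly (step_poly N).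
Proof.
split=> [|u v u0 uv v1]; first by rewrite step_polyE subr0 expr1n subrr.
by rewrite !step_polyE lerD2l lerN2 lerXn2r ?nnegrE ?subr_ge0 ?lerD2l ?lerN2// (le_trans uv).
Qed.

Lemma step_poly1 N : (step_poly N).[1] <= 1.
Proof. by rewrite step_polyE subrr gerBl exprn_ge0. Qed.

Lemma bernoulli_ge (u : K) N : -1 <= u -> 1 + N%:R * u <= (1 + u) ^+ N.
Proof.
move=> u1; elim: N => [|N IH]; first by rewrite mul0r addr0.
have u10 : 0 <= 1 + u by lra.
apply: (@le_trans _ _ ((1 + u) * (1 + N%:R * u))); last by rewrite exprS ler_wpM2l.
rewrite -subr_ge0 (_ : _ - _ = N%:R * u ^+ 2); last by rewrite -natr1; ring.
by rewrite mulr_ge0 ?ler0n ?sqr_ge0.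
Qed.

Lemma step_poly_le N u : 0 <= u <= 1 -> (step_poly N).[u] <= N%:R * u.
Proof.
move=> /andP[u0 u1]; rewrite step_polyE.
have := @bernoulli_ge (- u) N; rewrite lerN2 => /(_ u1); lra.
Qed.

(** Combines [(1 - u)^N (1 + u)^N <= 1] with Bernoulli's [N u <= (1 + u)^N]. *)
Lemma step_poly_ge N u : 0 <= u <= 1 -> 0 < N%:R * u ->
  1 - (N%:R * u)^-1 <= (step_poly N).[u].
Proof.
move=> /andP[u0 u1] Nu; rewrite step_polyE lerD2l lerN2.
rewrite -[leRHS]mul1r ler_pdivlMr//.
apply: (@le_trans _ _ ((1 - u) ^+ N * (1 + u) ^+ N)).
  rewrite ler_wpM2l ?exprn_ge0 ?subr_ge0//.
  by apply: le_trans (bernoulli_ge _ _); [rewrite lerDr|lra].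
rewrite -exprMn exprn_ile1//; last by nra.
by nra.
Qed.

End step_polynomials.

(** * Strict growth of the distribution function *)

Section strict_monotonicity.
Variable K : realType.

(** A drop of the window from at least 1/2 at [x] to at most 1/4 at [4 x] keeps both lower bounds
    away from 0, uniformly in [s] and [p]. *)
Lemma lfun1_window_lower (e c x : K) (i : bool) : 0 < e -> 1 < c -> 0 < x ->
  exists2 w, 0 < w & forall s p, 0 <= s -> window_poly p ->
    2^-1 <= p.[expR (- (s * x))] -> p.[expR (- (s * (4 * x)))] <= 4^-1 ->
    w <= lfun1 s p (fun t => t ^+ i * (1 + e * t) `^ (- c)).
Proof.
move=> e0 c1 x0; case: i.
  have [w w0 wP] := lfun1_gamma_deriv_lower e0 c1 x0.
  exists (w * 4^-1); first by rewrite mulr_gt0.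
  move=> s p s0 pw h1 h2; apply: le_trans (wP s p s0 pw).
  by rewrite ler_wpM2l ?(ltW w0)//; lra.
have [w w0 wP] := lfun1_gamma_lower e0 (lt_trans ltr01 c1) x0.
exists (w * 2^-1); first by rewrite mulr_gt0.
move=> s p s0 pw h1 h2.
rewrite (@eq_lfun1 _ _ _ (fun t => t ^+ false * (1 + e * t) `^ (- c))
  (fun t => (1 + e * t) `^ (- c)))//; last by move=> t _; rewrite mul1r.
by apply: le_trans (wP s p s0 pw); rewrite ler_wpM2l ?(ltW w0).
Qed.

Let half_le (z : K) : z <= 2^-1 -> 2^-1 <= 1 - z /\ 0 <= 1 - z.
Proof. by move=> z2; split; lra. Qed.

Let chain_le (a b c d l1 l2 C g s : K) : a <= b -> b <= l1 -> d <= C ->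
  C <= l2 - l1 -> l2 <= g + s -> s <= c -> a + d <= g + c.
Proof. by lra. Qed.

(** Windows with a jump near [(1 + h) x] compare the box at [x] under [mu1] with the box at
    [(1 + 2 h) x] under [mu2], with a fixed gain [delta]. The windows are sharpened first, then [h]
    tends to 0. *)
Lemma Gamma_cdf_lt n (A B : 'M[K]_n) (al : K) (x : 'I_n -> K) (x1 x2 : K)
    (mu1 mu2 : probability (n.-tuple K) K) i j :
  pdmx A -> offdiag_le0 (invmx A) -> pdmx (A + B) ->
  (forall k, A k k = 1) -> (forall k l, 0 < A k l) ->
  (forall k, B k k = 0) -> (forall k l, 0 <= B k l) -> i != j -> 0 < B i j ->
  0 < al -> (exists k : nat, 2 * (al + 1) = k%:R) \/ n%:R - 1 < 2 * (al + 1) ->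
  (forall k, 0 < x k) -> 0 <= x1 -> x1 < x2 -> x2 <= 1 ->
  is_Gamma al (A + x1 *: B) mu1 -> is_Gamma al (A + x2 *: B) mu2 ->
  fine (mu1 (lower_box x)) < fine (mu2 (lower_box x)).
Proof.
move=> Apd Aoff ABpd A1 A0 Bd B0 ij Bij al0 aln x0 x10 x12 x21 G1 G2.
have BT : B^T = B.
  have [AT _] := Apd; have [ABT _] := ABpd.
  by apply: (@addrI _ A); rewrite -[in LHS]AT -linearD.
have conv (e : K) : pdmx (A - e%:M) -> pdmx (A + B - e%:M) ->
    forall t, 0 <= t <= 1 -> pdmx (A + t *: B - e%:M).
  move=> H1 H2 t t01; have := pdmx_convex H1 H2 t01.
  rewrite (_ : A + B - e%:M - (A - e%:M) = B); last first.
    by rewrite opprB addrA subrK addrC addKr.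
  by rewrite addrAC.
have ABpd' t : 0 <= t <= 1 -> pdmx (A + t *: B).
  by move=> t01; have := @conv 0 _ _ t t01; rewrite raddf0 !subr0; apply.
have [eA [eA0 eAP]] := pdmx_sub_scalar Apd.
have [eB [eB0 eBP]] := pdmx_sub_scalar ABpd.
(* A single [e] serves the whole segment, by convexity from its two ends. *)
pose e := Num.min eA eB.
have e0 : 0 < e by rewrite lt_min eA0.
have epd t : 0 <= t <= 1 -> pdmx (A + t *: B - e%:M).
  by apply: conv; [apply: eAP|apply: eBP]; rewrite ge_min lexx ?orbT.
have c1 : 1 < al + 1 by rewrite ltrDr.
have /choice[w wP] (k : 'I_n) : exists w, 0 < w /\ forall s p, 0 <= s -> window_poly p ->
    2^-1 <= p.[expR (- (s * x k))] -> p.[expR (- (s * (4 * x k)))] <= 4^-1 ->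
    w <= lfun1 s p (fun t => t ^+ (k \in [set i; j]%SET) * (1 + e * t) `^ (- (al + 1))).
  have [w w0 wP] := lfun1_window_lower (k \in [set i; j]%SET) e0 c1 (x0 k).
  by exists w.
(* Neither [C] nor [delta] involves [m] or [h], so the gain survives both limits. *)
pose C := al * (x2 - x1) * (2 * A i j * B i j * (\det A / e ^+ n) `^ (- (al + 1))).
pose delta := C * \prod_k w k.
have C0 : 0 < C.
  rewrite !mulr_gt0 ?subr_gt0 ?powR_gt0// divr_gt0 ?exprn_gt0//.
  exact: pdmx_det_gt0.
have delta0 : 0 < delta.
  by rewrite mulr_gt0//; apply: prodr_gt0 => k _; case: (wP k).
suff : fine (mu1 (lower_box x)) + delta <= fine (mu2 (lower_box x)).
  by apply: lt_le_trans; rewrite ltrDl.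
have step h : 0 < h -> h <= 1 -> fine (mu1 (lower_box x)) + delta <=
    fine (mu2 (lower_box (fun k => (1 + 2 * h) * x k))).
  move=> h0 h1; pose la := 1 + h.
  have la0 : 0 < la by rewrite /la; lra.
  have h2 : 0 <= 1 + 2 * h by lra.
  have half1 : 2^-1 <= 1 :> K by lra.
  (* With [N = 2^m] and [s k = m * th k], the quantity [N exp(- s k * (r * x k))] is [q r ^+ m]. So
     the window jumps at [r = la], strictly between 1 and [1 + 2 h]. *)
  pose th k := ln 2 / (la * x k); pose q r : K := expR (ln 2 * (1 - r / la)).
  have th0 k : 0 <= th k by rewrite divr_ge0 ?mulr_ge0 ?ln_ge0 ?ler1n ?ltW.
  have qE m k r : (2 ^ m)%:R * expR (- (m%:R * th k * (r * x k))) = q r ^+ m.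
    rewrite natrX -mulrA -mulrN expRM_natl -exprMn; congr (_ ^+ _).
    rewrite -[2 in LHS](@lnK K) ?posrE// -expRD; congr expR.
    by rewrite /th; field; rewrite !gt_eqF.
  have ln20 : 0 < ln 2 :> K by rewrite ln_gt0// ltr1n.
  have q1 : 1 < q 1.
    rewrite /q expR_gt1 mulr_gt0// subr_gt0 div1r invf_lt1//.
    by rewrite /la; lra.
  have q2 : q (1 + 2 * h) < 1.
    rewrite /q expR_lt1 pmulr_rlt0// subr_lt0 ltr_pdivlMr// mul1r.
    by rewrite /la; lra.
  (* As [la <= 2], the point [4 * x k] lies well beyond the jump; for [m >= 2] this gives the value
     at most 1/4 demanded of the window. *)
  have q4 : q 4 <= 2^-1.
    rewrite -[2 in leRHS](@lnK K) ?posrE// -expRN ler_expR -[leRHS]mulrN1 ler_wpM2l ?(ltW ln20)//.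
    have : 2 <= 4 / la by rewrite ler_pdivlMr// /la; lra.
    by lra.
  set G1x := fine (mu1 _); set G2x := fine (mu2 _).
  have main m : (2 <= m)%N -> (q 1)^-1 ^+ m <= 2^-1 ->
      (1 - (q 1)^-1 ^+ m) ^+ n * G1x + delta <= G2x + n%:R * q (1 + 2 * h) ^+ m.
    move=> m2 qm; pose s k := m%:R * th k; pose p : {poly K} := step_poly K (2 ^ m).
    have s0 k : 0 <= s k by rewrite mulr_ge0// ler0n.
    have pw : window_poly p by exact: window_step_poly.
    have up k r : 0 <= r -> p.[expR (- (s k * (r * x k)))] <= q r ^+ m.
      move=> r0; rewrite -(qE m k) step_poly_le// expRN01//.
      by apply: mulr_ge0 => //; rewrite mulr_ge0// ltW.
    have lo k r : 0 <= r -> 1 - (q r ^+ m)^-1 <= p.[expR (- (s k * (r * x k)))].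
      move=> r0; rewrite -(qE m k) step_poly_ge// ?expRN01 ?qE ?exprn_gt0 ?expR_gt0//.
      by apply: mulr_ge0 => //; rewrite mulr_ge0// ltW.
    have lo1 k : 1 - (q 1)^-1 ^+ m <= p.[expR (- (s k * x k))].
      by rewrite -[x k]mul1r exprVn; exact: lo.
    have x0' k : 0 <= x k by exact: ltW.
    have H1 := cdf_window_le G1 s0 pw x0'.
    have rx0 k : 0 <= (1 + 2 * h) * x k by rewrite mulr_ge0.
    have H2 := window_le_cdf G2 s0 pw rx0 (step_poly1 _ _).
    have H3 := lfun_det_increment_lower Apd Aoff BT Bd B0 ABpd' al0 s0 e0 epd aln pw ij
      (A1 i) (A1 j) (fun k l => ltW (A0 k l)) x10 x12 x21.
    have H4 : delta <= C * \prod_k lfun1 (s k) p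
        (fun t => t ^+ (k \in [set i; j]%SET) * (1 + e * t) `^ (- (al + 1))).
      rewrite /delta ler_wpM2l ?(ltW C0)//; apply: ler_prod => k _.
      have [w0 wk] := wP k; rewrite ltW//=; apply: wk => //.
        by apply: le_trans (lo1 k); case: (half_le qm).
      apply: (le_trans (up k 4 _)) => //.
      apply: (@le_trans _ _ (2^-1 ^+ m)).
        by rewrite lerXn2r ?nnegrE ?expR_ge0 ?invr_ge0.
      rewrite (_ : 4^-1 = 2^-1 ^+ 2); last by field.
      by apply: ler_wiXn2l => //; rewrite invr_ge0.
    have H5 : (1 - (q 1)^-1 ^+ m) ^+ n * G1x <=
        (\prod_k p.[expR (- (s k * x k))]) * G1x.
      rewrite ler_wpM2r ?fine_ge0//.
      rewrite -[X in _ ^+ X](card_ord n) -prodr_const; apply: ler_prod => k _.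
      by rewrite lo1 andbT; case: (half_le qm).
    have H6 : \sum_k p.[expR (- (s k * ((1 + 2 * h) * x k)))] <=
        n%:R * q (1 + 2 * h) ^+ m.
      have -> : n%:R * q (1 + 2 * h) ^+ m = \sum_(k < n) q (1 + 2 * h) ^+ m.
        by rewrite sumr_const card_ord mulr_natl.
      by apply: ler_sum => k _; exact: up.
    move: H3; rewrite mulrA -/C => H3.
    exact: chain_le H5 H1 H4 H3 H2 H6.
  (* As [m] grows, the corner factor tends to 1 and the error term outside the box to 0. *)
  pose u m : K := (1 - (q 1)^-1 ^+ m) ^+ n * G1x + delta - n%:R * q (1 + 2 * h) ^+ m.
  have q10 : 0 < (q 1)^-1 by rewrite invr_gt0 expR_gt0.
  have q11 : `|(q 1)^-1| < 1 by rewrite ger0_norm ?ltW// invf_lt1 ?expR_gt0.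
  have q21 : `|q (1 + 2 * h)| < 1 by rewrite ger0_norm ?expR_ge0.
  have cq1 := cvg_expr q11; have cq2 := cvg_expr q21.
  have ucvg : u m @[m --> \oo] --> G1x + delta.
    have -> : G1x + delta = (1 - 0 : K) ^+ n * G1x + delta - n%:R * 0.
      by rewrite subr0 expr1n mul1r mulr0 subr0.
    apply: cvgB; last by apply: cvgMl_tmp.
    apply: cvgD; last exact: cvg_cst.
    apply: cvgMr_tmp; apply: (cvg_comp (fun m => 1 - (q 1)^-1 ^+ m) (fun z => z ^+ n)).
      by apply: (cvgB _ cq1); exact: cvg_cst.
    exact: exprn_continuous.
  rewrite -(cvg_lim _ ucvg)//; apply: limr_le.
    by apply/cvg_ex; eexists; exact: ucvg.
  near=> m; rewrite lerBlDr; apply: main.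
    by near: m; exact: nbhs_infty_ge.
  have : `|0 - (q 1)^-1 ^+ m| <= 2^-1.
    by near: m; move/cvgr_dist_le : cq1; apply; rewrite invr_gt0.
  by rewrite sub0r normrN ger0_norm// exprn_ge0// ltW.
(* The choice [h = 1 / (m + 1)]: the boxes decrease to [lower_box x], and continuity of [mu2] from
   above gives the limit. *)
pose c m : K := 1 + 2 * m.+1%:R^-1.
have c_ge m : 1 <= c m by rewrite lerDl mulr_ge0// invr_ge0.
have cE : lower_box x = \bigcap_m lower_box (fun k => c m * x k).
  apply/seteqP; split=> [y yx m _ k|y yx k].
    by apply: le_trans (yx k) _; rewrite ler_peMl// ltW.
  have cc : c m @[m --> \oo] --> (1 + 2 * 0 : K).
    by apply: cvgD; [exact: cvg_cst|apply: cvgMl_tmp; exact: cvg_harmonic].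
  have ck : c m * x k @[m --> \oo] --> x k.
    have : c m * x k @[m --> \oo] --> ((1 + 2 * 0) * x k : K) by exact: cvgMr_tmp.
    by rewrite mulr0 addr0 mul1r.
  rewrite -(cvg_lim _ ck)//; apply: limr_ge.
    by apply/cvg_ex; eexists; exact: ck.
  by apply: nearW => m; exact: yx.
have ccvg : mu2 (lower_box (fun k => c m * x k)) @[m --> \oo] --> mu2 (lower_box x).
  rewrite [X in _ --> mu2 X]cE; apply: nonincreasing_cvg_mu.
  - by rewrite -ge0_fin_numE// fin_num_measure//; exact: measurable_lower_box.
  - by move=> m; exact: measurable_lower_box.
  - by rewrite -cE; exact: measurable_lower_box.
  move=> m1 m2 m12; rewrite subsetEset => y yx k; apply: le_trans (yx k) _.
  rewrite ler_wpM2r ?(ltW (x0 k))// /c lerD2l ler_wpM2l// lef_pV2 ?posrE//.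
  by rewrite ler_nat.
have m2x := measurable_lower_box x.
rewrite -lee_fin [leRHS]fineK ?fin_num_measure//.
rewrite -(cvg_lim _ ccvg)//; apply: lime_ge.
  by apply/cvg_ex; eexists; exact: ccvg.
apply: nearW => m; rewrite -[leRHS]fineK ?fin_num_measure//; last exact: measurable_lower_box.
rewrite lee_fin; apply: step; first by rewrite invr_gt0.
by rewrite invf_le1// ler1n.
Unshelve. all: by end_near.
Qed.

End strict_monotonicity.

(** The law behind [Gamma_cdf] is picked by [cid]; the comparison above holds for any laws
    satisfying [is_Gamma], hence for the picked ones. *)
Lemma Gamma_cdfP (K : realType) n (alpha : K) (x : 'I_n -> K) (R : 'M[K]_n) :
  (exists mu, is_Gamma alpha R mu) ->
  exists2 mu : probability (n.-tuple K) K, is_Gamma alpha R mu &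
    Gamma_cdf alpha x R = fine (mu (lower_box x)).
Proof.
rewrite /Gamma_cdf; case: pselect => // Gex _.
by exists (projT1 (cid Gex)); first exact: (projT2 (cid Gex)).
Qed.

Theorem theorem4 (K : realType) (n : nat) (n_ge2 : (2 <= n)%N)
    (R R0 : 'M[K]_n)
    (R_corr : correlation_matrix R) (R_nonsing : R \in unitmx)
    (R0_corr : correlation_matrix R0) (R0_nonsing : R0 \in unitmx)
    (R0_le_R : forall i j, R0 i j <= R i j) (R_neq_R0 : R <> R0)
    (R0_pos : forall i j, 0 < R0 i j)
    (R0_inv : forall i j, i != j -> invmx R0 i j <= 0)
    (x : 'I_n -> K) (x_pos : forall j, 0 < x j)
    (alpha : K) (alpha_pos : 0 < alpha)
    (alpha_adm : (exists k : nat, (0 < k)%N /\ 2 * alpha = k%:R) \/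
                 n%:R - 2 < 2 * alpha) :
  (forall tau1 tau2 : K, 0 <= tau1 -> tau1 < tau2 -> tau2 <= 1 ->
     Gamma_cdf alpha x (R0 + tau1 *: (R - R0)) <
     Gamma_cdf alpha x (R0 + tau2 *: (R - R0))) /\
  Gamma_cdf alpha x R0 < Gamma_cdf alpha x R.
Proof.
case: n n_ge2 R R0 R_corr R_nonsing R0_corr R0_nonsing R0_le_R R_neq_R0 R0_pos
  R0_inv x x_pos alpha_adm => [//|m] n_ge2 R R0 Rc Ru R0c R0u R0R RR0 R0p R0i x xp adm.
have corr_pd (M : 'M[K]_m.+1) : correlation_matrix M -> M \in unitmx -> pdmx M.
  by case=> MT Mpsd _ Mu; apply: pdmx_unit_psd => //; split.
have Rpd := corr_pd _ Rc Ru; have R0pd := corr_pd _ R0c R0u.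
have [[_ _ R1] [_ _ R01]] := (Rc, R0c).
pose B := R - R0; have RE : R0 + B = R by rewrite addrC subrK.
have Gex t : 0 <= t <= 1 -> exists mu, is_Gamma alpha (R0 + t *: B) mu.
  move=> t01; apply: (@Gamma_exists K m) => //; first exact: pdmx_convex.
  (* The size is [n = m + 1], so [n - 2] is the bound [m - 1] of [Gamma_exists]. *)
  case: adm => [[k [_ kE]]|nlt]; [by left; exists k|right].
  by move: nlt; rewrite -(natr1 m); lra.
have [[i j] /= /negP ij] : exists ij : 'I_m.+1 * 'I_m.+1, ~ (R ij.1 ij.2 == R0 ij.1 ij.2).
  apply/existsNP => eqR; apply: RR0; apply/matrixP => i j.
  by apply/eqP; exact: (eqR (i, j)).
have main t1 t2 : 0 <= t1 -> t1 < t2 -> t2 <= 1 ->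
    Gamma_cdf alpha x (R0 + t1 *: B) < Gamma_cdf alpha x (R0 + t2 *: B).
  move=> t10 t12 t21.
  have /Gex/(Gamma_cdfP x)[mu1 G1 ->] : 0 <= t1 <= 1.
    by rewrite t10 (le_trans (ltW t12)).
  have /Gex/(Gamma_cdfP x)[mu2 G2 ->] : 0 <= t2 <= 1.
    by rewrite t21 (le_trans t10 (ltW t12)).
  apply: (@Gamma_cdf_lt K m.+1 R0 B alpha x t1 t2 mu1 mu2 i j R0pd R0i _ R01 R0p
    _ _ _ _ alpha_pos _ xp t10 t12 t21 G1 G2).
  - by rewrite RE.
  - by move=> k; rewrite !mxE R1 R01 subrr.
  - by move=> k l; rewrite !mxE subr_ge0.
  - by apply: contraNneq ij => ->; rewrite R1 R01.
  - by rewrite !mxE subr_gt0 lt_neqAle R0R andbT eq_sym.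
  (* Raising the shape by 1 adds 2 to [2 * alpha]: [k] becomes [k + 2], and the lower bound [n - 2]
     becomes [n], above the [n - 1] required for a Wishart matrix of full size [n]. *)
  - case: adm => [[k [_ kE]]|nlt]; last by right; lra.
    by left; exists k.+2; rewrite mulrDr kE mulr1 -natrD addn2.
split=> //; have := main 0 1 (lexx _) ltr01 (lexx _).
by rewrite scale0r addr0 scale1r RE.
Qed.
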